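(* For all $\Delta,\Gamma,\tau$ and terms $e,e'$ with $\Delta;\Gamma\vdash e:\tau$ and $\Delta;\Gamma\vdash e':\tau$: $\Delta;\Gamma\vdash e\lesssim^{log}_{\downarrow} e':\tau$ if and only if $\Delta;\Gamma\vdash e\lesssim^{ciu}_{\downarrow} e':\tau$.
   Context: Language. Types: $\tau ::= \alpha \mid \mathbf{1} \mid \tau_1\times\tau_2 \mid \tau_1\to\tau_2 \mid \mu\alpha.(\tau_1+\dots+\tau_n) \mid \forall\alpha.\tau$. Values: $v ::= x \mid \langle\rangle \mid \langle v_1,v_2\rangle \mid \lambda x.e \mid \mathsf{in}_i\,v \mid \Lambda\alpha.e$. Terms: $e ::= v \mid ? \mid \mathsf{proj}_i\,v \mid v\,e \mid \mathsf{case}\,v\,\mathsf{of}\,(\mathsf{in}_1 x_1\Rightarrow e_1\mid\dots\mid \mathsf{in}_n x_n\Rightarrow e_n) \mid v[\tau]$. Evaluation contexts: $E ::= [\,] \mid v\,E$. One-step reduction $\mapsto$: $\mathsf{proj}_i\langle v_1,v_2\rangle\mapsto v_i$; $(\lambda x.e)\,v\mapsto e[v/x]$; $(\Lambda\alpha.e)[\tau]\mapsto e[\tau/\alpha]$; $\mathsf{case}\,(\mathsf{in}_j v)\,\mathsf{of}(\dots\mid\mathsf{in}_j x_j\Rightarrow e_j\mid\dots)\mapsto e_j[v/x_j]$ (an unfold-fold reduction); $?\mapsto \underline{n}$ for every $n\in\mathbb N$; and $v\,e\mapsto v\,e'$ whenever $e\mapsto e'$. Here $\mathsf{nat}=\mu\alpha.(\mathbf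 1+\alpha)$, $\underline 0=\mathsf{in}_1\langle\rangle$, $\underline{n+1}=\mathsf{in}_2\,\underline n$. Typing $\Delta;\Gamma\vdash e:\tau$ is standard for a call-by-value polymorphic lambda calculus with iso-recursive sums ($\mathsf{in}_j v:\mu\alpha.(\tau_1+\dots+\tau_n)$ when $v:\tau_j[\mu\alpha.(\dots)/\alpha]$; case branches bind $x_j:\tau_j[\mu\alpha.(\dots)/\alpha]$; $?:\mathsf{nat}$; $\Lambda\alpha.e:\forall\alpha.\tau$; $v[\tau']:\tau[\tau'/\alpha]$). $\mathsf{Type}$ = closed types; $\mathrm{Val}(\tau),\mathrm{Tm}(\tau)$ = closed values/terms of type $\tau$; $\mathrm{Stk}(\tau)$ = evaluation contexts $E$ with $E[e]$ closed well-typed for every $e\in\mathrm{Tm}(\tau)$; $\mathrm{Subst}(\Gamma)$ = substitutions mapping each $x{:}\sigma\in\Gamma$ into $\mathrm{Val}(\sigma)$. $e\downarrow$ means $e\mapsto^*v$ for some value $v$; $e\downarrow_n$ means this holds via a reduction sequence at most $n$ of whose steps are unfold-fold reductions. May-CIU preorder: $\Delta;\Gamma\vdash e\lesssim^{ciu}_{\downarrow} e':\tau$ iff for all $\delta\in\mathsf{Type}^\Delta$, $\gamma\in\mathrm{Subst}(\Gamma\delta)$, $E\in\mathrm{Stk}(\tau\delta)$: $E[e\delta\gamma]\downarrow$ implies $E[e'\delta\gamma]\downarrow$. Logical relation. An $\omega$-indexed uniform subset of $X$ is a sequence $(r_n)_{n<\omega}$ of subsets of $X$ with $r_0=X$ and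 $r_{n+1}\subseteq r_n$. For closed $\sigma,\sigma'$, $\mathrm{VRel}_\omega(\sigma,\sigma')$ is the set of such subsets of $\mathrm{Val}(\sigma)\times\mathrm{Val}(\sigma')$. For $r\in\mathrm{VRel}_\omega(\sigma,\sigma')$: $r^{\top}_n=\{(E,E')\in\mathrm{Stk}(\sigma)\times\mathrm{Stk}(\sigma')\mid\forall j\le n\,\forall(v,v')\in r_j.\ E[v]\downarrow_j\Rightarrow E'[v']\downarrow\}$ and $r^{\top\top}_n=\{(e,e')\in\mathrm{Tm}(\sigma)\times\mathrm{Tm}(\sigma')\mid\forall j\le n\,\forall(E,E')\in r^\top_j.\ E[e]\downarrow_j\Rightarrow E'[e']\downarrow\}$. For $\tau$ with free type variables among $\alpha_1,\dots,\alpha_k$ and $r_i\in\mathrm{VRel}_\omega(\sigma_i,\sigma_i')$, define $[\![\tau]\!](\vec r)\in\mathrm{VRel}_\omega(\tau[\vec\sigma/\vec\alpha],\tau[\vec\sigma'/\vec\alpha])$ by induction on $\tau$: $[\![\alpha_i]\!](\vec r)=r_i$; $[\![\mathbf 1]\!](\vec r)_n=\{(\langle\rangle,\langle\rangle)\}$; $[\![\tau_1\times\tau_2]\!](\vec r)_n=\{(\langle v_1,v_2\rangle,\langle v_1',v_2'\rangle)\mid (v_i,v_i')\in[\![\tau_i]\!](\vec r)_n\}$; $[\![\tau_1\to\tau_2]\!](\vec r)_n=\{(\lambda x.e,\lambda x.e')\mid\forall m\le n\,\forall(v,v')\in[\![\tau_1]\!](\vec r)_m.\ (e[v/x],e'[v'/x])\in([\![\tau_2]\!](\vec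 r))^{\top\top}_m\}$; $[\![\forall\alpha.\tau]\!](\vec r)_n=\{(\Lambda\alpha.e,\Lambda\alpha.e')\mid\forall\rho,\rho'\in\mathsf{Type}\,\forall s\in\mathrm{VRel}_\omega(\rho,\rho').\ (e[\rho/\alpha],e'[\rho'/\alpha])\in([\![\tau]\!](\vec r,s))^{\top\top}_n\}$; $[\![\mu\alpha.(\tau_1+\dots+\tau_m)]\!](\vec r)$ is the unique uniform relation $t$ such that $t_0$ contains all pairs of values of the two types and $t_{n+1}=\{(\mathsf{in}_jv,\mathsf{in}_jv')\mid 1\le j\le m,\ (v,v')\in[\![\tau_j]\!](\vec r,t)_n\}$. $(\gamma,\gamma')\in[\![\Gamma]\!](\vec r)_n$ iff $(\gamma(x),\gamma'(x))\in[\![\tau]\!](\vec r)_n$ for all $x{:}\tau\in\Gamma$. For $\Delta=\vec\alpha$: $\Delta;\Gamma\vdash e\lesssim^{log}_{\downarrow}e':\tau$ iff both are well-typed and for all closed $\vec\sigma,\vec\sigma'$, all $\vec r\in\mathrm{VRel}_\omega(\vec\sigma,\vec\sigma')$, all $n<\omega$ and all $(\gamma,\gamma')\in[\![\Gamma]\!](\vec r)_n$, $(e[\vec\sigma/\vec\alpha]\gamma,e'[\vec\sigma'/\vec\alpha]\gamma')\in([\![\tau]\!](\vec r))^{\top\top}_n$.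
   Formalization: The bound in e↓_n is read as fewer than n unfold-fold reductions, not at most n: with ''at most n'', ⟦1→1⟧_0 is not full, so ⟦τ⟧(r) is not always a uniform relation, and some term with a free x:∀α.α×α→α is not log-related to itself. *)

(* Defs.v *)
From mathcomp Require Import all_boot.

Set Implicit Arguments.
Unset Strict Implicit.
Unset Printing Implicit Defensive.

(** * Syntax, with de Bruijn indices *)

(* [TMu ts] is mu alpha.(t_1 + ... + t_n); it binds one variable in every
   summand, and the summands (and the injections [In j]) are numbered from 0. *)
Inductive ty : Type :=
| TVar of nat
| TUnit
| TProd of ty & ty
| TArr of ty & ty
| TMu of seq ty
| TAll of ty.

(* Term variables and type variables are indexed separately.  [Lam] and each
   branch of [Case] bind one term variable, [TLam] binds one type variable.
   [Proj true] is proj_1 and [Proj false] is proj_2. *)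
Inductive val : Type :=
| Var of nat
| Unit
| Pair of val & val
| Lam of tm
| In of nat & val
| TLam of tm
with tm : Type :=
| Ret of val
| Any
| Proj of bool & val
| App of val & tm
| Case of val & seq tm
| TApp of val & ty.

Inductive ectx : Type :=
| Hole
| AppR of val & ectx.

Fixpoint plug (E : ectx) (e : tm) : tm :=
  if E is AppR v E' then App v (plug E' e) else e.

(** * Simultaneous substitution *)

Definition scons (T : Type) (x : T) (s : nat -> T) (i : nat) : T :=
  if i is j.+1 then s j else x.

Definition upr (r : nat -> nat) : nat -> nat := scons 0 (fun i => (r i).+1).

Fixpoint ren_ty (r : nat -> nat) (t : ty) : ty :=
  match t with
  | TVar i => TVar (r i)
  | TUnit => TUnit
  | TProd a b => TProd (ren_ty r a) (ren_ty r b)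
  | TArr a b => TArr (ren_ty r a) (ren_ty r b)
  | TMu ts => TMu (map (ren_ty (upr r)) ts)
  | TAll a => TAll (ren_ty (upr r) a)
  end.

Definition upty (s : nat -> ty) : nat -> ty :=
  scons (TVar 0) (fun i => ren_ty succn (s i)).

Fixpoint subst_ty (s : nat -> ty) (t : ty) : ty :=
  match t with
  | TVar i => s i
  | TUnit => TUnit
  | TProd a b => TProd (subst_ty s a) (subst_ty s b)
  | TArr a b => TArr (subst_ty s a) (subst_ty s b)
  | TMu ts => TMu (map (subst_ty (upty s)) ts)
  | TAll a => TAll (subst_ty (upty s) a)
  end.

Fixpoint tsubst_val (s : nat -> ty) (v : val) : val :=
  match v with
  | Var x => Var x
  | Unit => Unit
  | Pair v1 v2 => Pair (tsubst_val s v1) (tsubst_val s v2)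
  | Lam e => Lam (tsubst_tm s e)
  | In j v1 => In j (tsubst_val s v1)
  | TLam e => TLam (tsubst_tm (upty s) e)
  end
with tsubst_tm (s : nat -> ty) (e : tm) : tm :=
  match e with
  | Ret v => Ret (tsubst_val s v)
  | Any => Any
  | Proj b v => Proj b (tsubst_val s v)
  | App v e1 => App (tsubst_val s v) (tsubst_tm s e1)
  | Case v bs => Case (tsubst_val s v) (map (tsubst_tm s) bs)
  | TApp v t => TApp (tsubst_val s v) (subst_ty s t)
  end.

Fixpoint ren_val (r : nat -> nat) (v : val) : val :=
  match v with
  | Var x => Var (r x)
  | Unit => Unit
  | Pair v1 v2 => Pair (ren_val r v1) (ren_val r v2)
  | Lam e => Lam (ren_tm (upr r) e)
  | In j v1 => In j (ren_val r v1)
  | TLam e => TLam (ren_tm r e)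
  end
with ren_tm (r : nat -> nat) (e : tm) : tm :=
  match e with
  | Ret v => Ret (ren_val r v)
  | Any => Any
  | Proj b v => Proj b (ren_val r v)
  | App v e1 => App (ren_val r v) (ren_tm r e1)
  | Case v bs => Case (ren_val r v) (map (ren_tm (upr r)) bs)
  | TApp v t => TApp (ren_val r v) t
  end.

Definition upval (g : nat -> val) : nat -> val :=
  scons (Var 0) (fun x => ren_val succn (g x)).

(* Shifts the type variables of the values in [g], to go under a [TLam]. *)
Definition upval_ty (g : nat -> val) : nat -> val :=
  fun x => tsubst_val (fun i => TVar i.+1) (g x).

Fixpoint subst_val (g : nat -> val) (v : val) : val :=
  match v with
  | Var x => g x
  | Unit => Unit
  | Pair v1 v2 => Pair (subst_val g v1) (subst_val g v2)
  | Lam e => Lam (subst_tm (upval g) e)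
  | In j v1 => In j (subst_val g v1)
  | TLam e => TLam (subst_tm (upval_ty g) e)
  end
with subst_tm (g : nat -> val) (e : tm) : tm :=
  match e with
  | Ret v => Ret (subst_val g v)
  | Any => Any
  | Proj b v => Proj b (subst_val g v)
  | App v e1 => App (subst_val g v) (subst_tm g e1)
  | Case v bs => Case (subst_val g v) (map (subst_tm (upval g)) bs)
  | TApp v t => TApp (subst_val g v) t
  end.

Definition subst_ty1 (t : ty) (a : ty) : ty := subst_ty (scons t TVar) a.
Definition tsubst_tm1 (t : ty) (e : tm) : tm := tsubst_tm (scons t TVar) e.
Definition subst_tm1 (v : val) (e : tm) : tm := subst_tm (scons v Var) e.

(** * Typing *)

Definition tnat : ty := TMu [:: TUnit; TVar 0].

Fixpoint num (n : nat) : val :=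
  if n is m.+1 then In 1 (num m) else In 0 Unit.

Fixpoint wf_ty (k : nat) (t : ty) : bool :=
  match t with
  | TVar i => i < k
  | TUnit => true
  | TProd a b => wf_ty k a && wf_ty k b
  | TArr a b => wf_ty k a && wf_ty k b
  | TMu ts => all (wf_ty k.+1) ts
  | TAll a => wf_ty k.+1 a
  end.

(* Delta is the number [k] of type variables in scope; Gamma is a list of
   types, the term variable [x] having the type at position [x]. *)
Inductive val_typed (k : nat) (G : seq ty) : val -> ty -> Prop :=
| T_Var x t : onth G x = Some t -> val_typed k G (Var x) t
| T_Unit : val_typed k G Unit TUnit
| T_Pair v1 v2 a b :
    val_typed k G v1 a -> val_typed k G v2 b ->
    val_typed k G (Pair v1 v2) (TProd a b)
| T_Lam e a b :
    wf_ty k a -> tm_typed k (a :: G) e b ->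
    val_typed k G (Lam e) (TArr a b)
| T_In j v ts t :
    wf_ty k (TMu ts) -> onth ts j = Some t ->
    val_typed k G v (subst_ty1 (TMu ts) t) ->
    val_typed k G (In j v) (TMu ts)
| T_TLam e a :
    tm_typed k.+1 (map (ren_ty succn) G) e a ->
    val_typed k G (TLam e) (TAll a)
with tm_typed (k : nat) (G : seq ty) : tm -> ty -> Prop :=
| T_Ret v t : val_typed k G v t -> tm_typed k G (Ret v) t
| T_Any : tm_typed k G Any tnat
| T_Proj b v t1 t2 :
    val_typed k G v (TProd t1 t2) ->
    tm_typed k G (Proj b v) (if b then t1 else t2)
| T_App v e a b :
    val_typed k G v (TArr a b) -> tm_typed k G e a ->
    tm_typed k G (App v e) b
| T_Case v bs ts t :
    val_typed k G v (TMu ts) -> wf_ty k t -> size bs = size ts ->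
    (forall j a b, onth ts j = Some a -> onth bs j = Some b ->
       tm_typed k (subst_ty1 (TMu ts) a :: G) b t) ->
    tm_typed k G (Case v bs) t
| T_TApp v a t :
    val_typed k G v (TAll a) -> wf_ty k t ->
    tm_typed k G (TApp v t) (subst_ty1 t a).

Definition wf_ctx (k : nat) (G : seq ty) : bool := all (wf_ty k) G.

Definition Val (t : ty) (v : val) : Prop := val_typed 0 [::] v t.

Definition Tm (t : ty) (e : tm) : Prop := tm_typed 0 [::] e t.

Definition Stk (t : ty) (E : ectx) : Prop :=
  forall e, Tm t e -> exists u, Tm u (plug E e).

(** * Reduction *)

(* The boolean label is [true] exactly for unfold-fold reductions. *)
Inductive step : bool -> tm -> tm -> Prop :=
| S_Proj b v1 v2 :
    step false (Proj b (Pair v1 v2)) (Ret (if b then v1 else v2))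
| S_Beta e v : step false (App (Lam e) (Ret v)) (subst_tm1 v e)
| S_TBeta e t : step false (TApp (TLam e) t) (tsubst_tm1 t e)
| S_Case j v bs e :
    onth bs j = Some e -> step true (Case (In j v) bs) (subst_tm1 v e)
| S_Any n : step false Any (Ret (num n))
| S_App l v e e' : step l e e' -> step l (App v e) (App v e').

(* [reds n e e'] : a reduction sequence from [e] to [e'] in which exactly [n]
   steps are unfold-fold reductions. *)
Inductive reds : nat -> tm -> tm -> Prop :=
| R_refl e : reds 0 e e
| R_step (l : bool) n e e' e'' :
    step l e e' -> reds n e' e'' -> reds (l + n) e e''.

Definition may_conv (e : tm) : Prop := exists n v, reds n e (Ret v).

(* The bound is strict, so that nothing converges at index 0.  This is what
   makes [biorth] total at index 0, hence what makes [interp] below a uniform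
   relation (level 0 full) at arrow and universal types.  With the bound
   [m <= n] these interpretations are not full at level 0: the pair of
   fun x => <> and fun x => Omega is missing from 1 -> 1.  A universal type,
   which quantifies over uniform relations only, then cannot be instantiated
   with the interpretation of 1 -> 1, and [logrel] is not reflexive. *)
Definition may_conv_in (n : nat) (e : tm) : Prop :=
  exists m v, m < n /\ reds m e (Ret v).

Definition Subst (G : seq ty) (g : nat -> val) : Prop :=
  forall x t, onth G x = Some t -> Val t (g x).

(* The components of [d] beyond [k], like those of the environments [h] below,
   are irrelevant. *)
Definition closing (k : nat) (d : nat -> ty) : Prop :=
  forall i, i < k -> wf_ty 0 (d i).

Definition ciu (k : nat) (G : seq ty) (e e' : tm) (t : ty) : Prop :=
  forall d g E, closing k d -> Subst (map (subst_ty d) G) g ->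
    Stk (subst_ty d t) E ->
    may_conv (plug E (subst_tm g (tsubst_tm d e))) ->
    may_conv (plug E (subst_tm g (tsubst_tm d e'))).

(** * Logical relation *)

Definition urel : Type := nat -> val -> val -> Prop.

Definition VRel (t t' : ty) (r : urel) : Prop :=
  (forall v v', r 0 v v' <-> Val t v /\ Val t' v') /\
  (forall n v v', r n.+1 v v' -> r n v v').

Definition orth (t t' : ty) (r : urel) (n : nat) (E E' : ectx) : Prop :=
  [/\ Stk t E, Stk t' E' &
      forall j v v', j <= n -> r j v v' ->
        may_conv_in j (plug E (Ret v)) -> may_conv (plug E' (Ret v'))].

Definition biorth (t t' : ty) (r : urel) (n : nat) (e e' : tm) : Prop :=
  [/\ Tm t e, Tm t' e' &
      forall j E E', j <= n -> orth t t' r j E E' ->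
        may_conv_in j (plug E e) -> may_conv (plug E' e')].

Record tyrel : Type := TyRel { lty : ty; rty : ty; trel : urel }.

Definition lsub (h : nat -> tyrel) (t : ty) : ty := subst_ty (fun i => lty (h i)) t.
Definition rsub (h : nat -> tyrel) (t : ty) : ty := subst_ty (fun i => rty (h i)) t.

(* [mu_sol t t' Fs s]: [s] is a uniform relation (in particular s_0 is full)
   with s_(n+1) = {(in_j w, in_j w') | (w, w') in (F_j s)_n}. *)
Definition mu_sol (t t' : ty) (Fs : seq (urel -> urel)) (s : urel) : Prop :=
  VRel t t' s /\
  forall n v v', s n.+1 v v' <->
    exists j F w w',
      [/\ onth Fs j = Some F, v = In j w, v' = In j w' & F s n w w'].

(* At recursive types [interp] is the unique solution of [mu_sol]; the summands
   are interpreted before one is selected for the sake of the guard condition. *)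
Fixpoint interp (t : ty) (h : nat -> tyrel) (n : nat) (v v' : val) : Prop :=
  match t with
  | TVar i => trel (h i) n v v'
  | TUnit => v = Unit /\ v' = Unit
  | TProd a b => exists v1 v2 v1' v2',
      [/\ v = Pair v1 v2, v' = Pair v1' v2',
          interp a h n v1 v1' & interp b h n v2 v2']
  | TArr a b =>
      [/\ Val (lsub h t) v, Val (rsub h t) v' &
      exists e e', [/\ v = Lam e, v' = Lam e' &
        forall m w w', m <= n -> interp a h m w w' ->
          biorth (lsub h b) (rsub h b) (interp b h) m
                 (subst_tm1 w e) (subst_tm1 w' e')]]
  | TMu ts => exists s,
      mu_sol (lsub h t) (rsub h t)
        (map (fun a s' => interp a (scons (TyRel (lsub h t) (rsub h t) s') h)) ts)
        s /\ s n v v'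
  | TAll a =>
      [/\ Val (lsub h t) v, Val (rsub h t) v' &
      exists e e', [/\ v = TLam e, v' = TLam e' &
        forall u u' s, wf_ty 0 u -> wf_ty 0 u' -> VRel u u' s ->
          let h' := scons (TyRel u u' s) h in
          biorth (lsub h' a) (rsub h' a) (interp a h') n
                 (tsubst_tm1 u e) (tsubst_tm1 u' e')]]
  end.

Definition rel_env (k : nat) (h : nat -> tyrel) : Prop :=
  forall i, i < k ->
    [/\ wf_ty 0 (lty (h i)), wf_ty 0 (rty (h i)) &
        VRel (lty (h i)) (rty (h i)) (trel (h i))].

Definition interp_ctx (G : seq ty) (h : nat -> tyrel) (n : nat)
    (g g' : nat -> val) : Prop :=
  forall x t, onth G x = Some t -> interp t h n (g x) (g' x).

Definition logrel (k : nat) (G : seq ty) (e e' : tm) (t : ty) : Prop :=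
  [/\ tm_typed k G e t, tm_typed k G e' t &
      forall h n g g', rel_env k h -> interp_ctx G h n g g' ->
        biorth (lsub h t) (rsub h t) (interp t h) n
          (subst_tm g (tsubst_tm (fun i => lty (h i)) e))
          (subst_tm g' (tsubst_tm (fun i => rty (h i)) e'))].

(* Main.v *)
(* The logical relation is closed under all term formers (fundamental
   theorem), so every well-typed term is related to itself.
   From ciu to log: if e ~ e by the fundamental theorem and (E, E') are related
   contexts, then E[e] converging in n steps gives E'[e] converging, hence
   E'[e'] converging by ciu.
   From log to ciu: interpret each type variable by the logical relation at the
   closed type substituted for it.  By the substitution lemma for the
   interpretation, the closing values are related to themselves, and it remains
   to relate every E in Stk(t) to itself.  Contexts carry no type of their own,
   but a closed term whose only type is t (see [probe]) shows that E is typable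
   with a hole of type t, and the fundamental theorem applies to its values. *)
Require Import Defs.
From mathcomp Require Import all_boot.
From Stdlib Require Import FunctionalExtensionality PropExtensionality.

Set Implicit Arguments.
Unset Strict Implicit.
Unset Printing Implicit Defensive.

(** * Lookup in lists and induction principles for the syntax *)

Definition all_onth (T : Type) (P : T -> Prop) (s : seq T) : Prop :=
  forall j a, onth s j = Some a -> P a.

Lemma all_onth_nil (T : Type) (P : T -> Prop) : all_onth P [::].
Proof. by case. Qed.

Lemma all_onth_cons (T : Type) (P : T -> Prop) x s :
  P x -> all_onth P s -> all_onth P (x :: s).
Proof. by move=> Px Ps [|j] a; [case=> <- | apply: Ps]. Qed.

Lemma eq_map_onth (T U : Type) (f f' : T -> U) s :
  all_onth (fun x => f x = f' x) s -> map f s = map f' s.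
Proof.
elim: s => //= x s IHs Hs; rewrite (Hs 0 x) // IHs // => j a.
exact: (Hs j.+1).
Qed.

Lemma all_onthP (T : Type) (p : pred T) s : reflect (all_onth p s) (all p s).
Proof.
apply: (iffP idP).
  by elim: s => [|x s IHs] /=; [move=> _ [] | case/andP=> px /IHs; apply: all_onth_cons].
elim: s => //= x s IHs Hs; rewrite (Hs 0 x) //=.
by apply: IHs => j; apply: (Hs j.+1).
Qed.

Lemma onth_map_inv (T U : Type) (f : T -> U) s j y :
  onth (map f s) j = Some y -> exists2 x, onth s j = Some x & y = f x.
Proof.
elim: s j => [[]|x s IHs [|j]] //=; last exact: IHs.
by case=> <-; exists x.
Qed.

(** The generated principle gives no hypothesis for the summands nested in the list of [TMu]. A
    direct fixpoint with an inner induction on that list supplies it. *)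
Lemma ty_onth_ind (P : ty -> Prop) :
  (forall i, P (TVar i)) -> P TUnit ->
  (forall a b, P a -> P b -> P (TProd a b)) ->
  (forall a b, P a -> P b -> P (TArr a b)) ->
  (forall ts, all_onth P ts -> P (TMu ts)) ->
  (forall a, P a -> P (TAll a)) -> forall t, P t.
Proof.
move=> Hvar Hunit Hprod Harr Hmu Hall; fix IH 1 => -[i||a b|a b|ts|a].
- exact: Hvar.
- exact: Hunit.
- exact: Hprod.
- exact: Harr.
- apply: Hmu; elim: ts => [|x s IHs]; first exact: all_onth_nil.
  exact: all_onth_cons.
- exact: Hall.
Qed.

(** Values and terms are mutual, and [Case] nests terms in a list. A mutual [fix] delivers only one
    of its components, so the half for values is obtained first and a second fixpoint for terms uses
    it. *)
Lemma val_tm_ind (P : Defs.val -> Prop) (Q : tm -> Prop) :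
  (forall i, P (Var i)) -> P Unit ->
  (forall v w, P v -> P w -> P (Pair v w)) ->
  (forall e, Q e -> P (Lam e)) ->
  (forall j v, P v -> P (In j v)) ->
  (forall e, Q e -> P (TLam e)) ->
  (forall v, P v -> Q (Ret v)) -> Q Any ->
  (forall b v, P v -> Q (Proj b v)) ->
  (forall v e, P v -> Q e -> Q (App v e)) ->
  (forall v bs, P v -> all_onth Q bs -> Q (Case v bs)) ->
  (forall v t, P v -> Q (TApp v t)) ->
  (forall v, P v) /\ (forall e, Q e).
Proof.
move=> Hvar Hunit Hpair Hlam Hin Htlam Hret Hany Hproj Happ Hcase Htapp.
have PV : forall v, P v.
  fix IHv 1 with (IHe (e : tm) {struct e} : Q e).
    case=> [i||v w|e|j v|e].
    - exact: Hvar.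
    - exact: Hunit.
    - exact: Hpair.
    - exact/Hlam/IHe.
    - exact: Hin.
    - exact/Htlam/IHe.
  case=> [v||b v|v e|v bs|v t].
  - exact: Hret.
  - exact: Hany.
  - exact: Hproj.
  - by apply: Happ; [apply: IHv | apply: IHe].
  - apply: Hcase; first exact: IHv.
    elim: bs => [|b s IHs]; first exact: all_onth_nil.
    by apply: all_onth_cons => //; apply: IHe.
  - exact: Htapp.
split=> //; fix IHe 1 => -[v||b v|v e|v bs|v t].
- exact: Hret.
- exact: Hany.
- exact: Hproj.
- exact: Happ.
- apply: Hcase; first exact: PV.
  elim: bs => [|b s IHs]; first exact: all_onth_nil.
  exact: all_onth_cons.
- exact: Htapp.
Qed.

(** * Substitution algebra *)

(** Every identity between substitutions lifted under a binder is reduced by this to the bound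
    variable and a shifted variable. *)
Lemma scons_eta (T : Type) (f : nat -> T) (g : nat -> T) x :
  f 0 = x -> (forall i, f i.+1 = g i) -> f = scons x g.
Proof. by move=> f0 fS; apply: functional_extensionality => -[]. Qed.

Lemma ren_tyE r t : ren_ty r t = subst_ty (fun i => TVar (r i)) t.
Proof.
elim/ty_onth_ind: t r => //= [a b IHa IHb|a b IHa IHb|ts IHts|a IHa] r.
- by rewrite IHa IHb.
- by rewrite IHa IHb.
- congr TMu; apply: eq_map_onth => j a /IHts ->; congr subst_ty.
  exact: scons_eta.
- by rewrite IHa; congr (TAll (subst_ty _ _)); apply: scons_eta.
Qed.

(** Lifting a substitution involves a shift, so composition is built in stages: substitution after
    renaming, renaming after substitution, and only then substitution after substitution. Value
    substitutions follow the same order. *)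
Lemma subst_ren_ty s r t : subst_ty s (ren_ty r t) = subst_ty (fun i => s (r i)) t.
Proof.
have up r1 s1 : (fun i => upty s1 (upr r1 i)) = upty (fun i => s1 (r1 i)).
  exact: scons_eta.
elim/ty_onth_ind: t r s => //= [a b IHa IHb|a b IHa IHb|ts IHts|a IHa] r s.
- by rewrite IHa IHb.
- by rewrite IHa IHb.
- rewrite -map_comp; congr TMu; apply: eq_map_onth => j a /IHts IH.
  by rewrite /= IH up.
- by rewrite IHa up.
Qed.

Lemma ren_subst_ty r s t : ren_ty r (subst_ty s t) = subst_ty (fun i => ren_ty r (s i)) t.
Proof.
have up r1 s1 : (fun i => ren_ty (upr r1) (upty s1 i)) = upty (fun i => ren_ty r1 (s1 i)).
  by apply: scons_eta => // i /=; rewrite [LHS]ren_tyE [RHS]ren_tyE !subst_ren_ty.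
elim/ty_onth_ind: t r s => //= [a b IHa IHb|a b IHa IHb|ts IHts|a IHa] r s.
- by rewrite IHa IHb.
- by rewrite IHa IHb.
- rewrite -map_comp; congr TMu; apply: eq_map_onth => j a /IHts IH.
  by rewrite /= IH up.
- by rewrite IHa up.
Qed.

Lemma upty_subst s s' :
  (fun i => subst_ty (upty s) (upty s' i)) = upty (fun i => subst_ty s (s' i)).
Proof. by apply: scons_eta => // i /=; rewrite subst_ren_ty ren_subst_ty. Qed.

Lemma subst_subst_ty s s' t :
  subst_ty s (subst_ty s' t) = subst_ty (fun i => subst_ty s (s' i)) t.
Proof.
elim/ty_onth_ind: t s s' => //= [a b IHa IHb|a b IHa IHb|ts IHts|a IHa] s s'.
- by rewrite IHa IHb.
- by rewrite IHa IHb.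
- rewrite -map_comp; congr TMu; apply: eq_map_onth => j a /IHts IH.
  by rewrite /= IH upty_subst.
- by rewrite IHa upty_subst.
Qed.

Lemma upty_id : upty TVar = TVar.
Proof. by apply/esym/scons_eta. Qed.

Lemma subst_ty_id t : subst_ty TVar t = t.
Proof.
elim/ty_onth_ind: t => //= [a b -> ->|a b -> ->|ts IHts|a IHa] //; rewrite upty_id.
- by congr TMu; rewrite -[RHS]map_id; apply: eq_map_onth.
- by rewrite IHa.
Qed.

Lemma tsubst_tsubst :
  (forall v s s', tsubst_val s (tsubst_val s' v) =
                  tsubst_val (fun i => subst_ty s (s' i)) v) /\
  (forall e s s', tsubst_tm s (tsubst_tm s' e) =
                  tsubst_tm (fun i => subst_ty s (s' i)) e).
Proof.
apply: val_tm_ind => //=.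
- by move=> v w IHv IHw s s'; rewrite IHv IHw.
- by move=> e IHe s s'; rewrite IHe.
- by move=> j v IHv s s'; rewrite IHv.
- by move=> e IHe s s'; rewrite IHe upty_subst.
- by move=> v IHv s s'; rewrite IHv.
- by move=> b v IHv s s'; rewrite IHv.
- by move=> v e IHv IHe s s'; rewrite IHv IHe.
- move=> v bs IHv IHbs s s'; rewrite IHv -map_comp; congr Case.
  by apply: eq_map_onth => j b /IHbs IH /=.
- by move=> v t IHv s s'; rewrite IHv subst_subst_ty.
Qed.

Lemma tsubst_id :
  (forall v, tsubst_val TVar v = v) /\ (forall e, tsubst_tm TVar e = e).
Proof.
apply: val_tm_ind => //=; rewrite ?upty_id.
- by move=> v w -> ->.
- by move=> e ->.
- by move=> j v ->.
- by move=> e ->.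
- by move=> v ->.
- by move=> b v ->.
- by move=> v e -> ->.
- by move=> v bs -> IHbs; rewrite -[in RHS](map_id bs); congr Case; apply: eq_map_onth.
- by move=> v t ->; rewrite subst_ty_id.
Qed.

Lemma tsubst_ren :
  (forall v s r, tsubst_val s (ren_val r v) = ren_val r (tsubst_val s v)) /\
  (forall e s r, tsubst_tm s (ren_tm r e) = ren_tm r (tsubst_tm s e)).
Proof.
apply: val_tm_ind => //=.
- by move=> v w IHv IHw s r; rewrite IHv IHw.
- by move=> e IHe s r; rewrite IHe.
- by move=> j v IHv s r; rewrite IHv.
- by move=> e IHe s r; rewrite IHe.
- by move=> v IHv s r; rewrite IHv.
- by move=> b v IHv s r; rewrite IHv.
- by move=> v e IHv IHe s r; rewrite IHv IHe.
- move=> v bs IHv IHbs s r; rewrite IHv -!map_comp; congr Case.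
  by apply: eq_map_onth => j b /IHbs IH /=.
- by move=> v t IHv s r; rewrite IHv.
Qed.

Lemma upval_id : upval Var = Var.
Proof. by apply/esym/scons_eta. Qed.

Lemma subst_ren :
  (forall v g r, subst_val g (ren_val r v) = subst_val (fun x => g (r x)) v) /\
  (forall e g r, subst_tm g (ren_tm r e) = subst_tm (fun x => g (r x)) e).
Proof.
have up r g : (fun i => upval g (upr r i)) = upval (fun i => g (r i)).
  exact: scons_eta.
apply: val_tm_ind => //=.
- by move=> v w IHv IHw g r; rewrite IHv IHw.
- by move=> e IHe g r; rewrite IHe up.
- by move=> j v IHv g r; rewrite IHv.
- by move=> e IHe g r; rewrite IHe.
- by move=> v IHv g r; rewrite IHv.
- by move=> b v IHv g r; rewrite IHv.
- by move=> v e IHv IHe g r; rewrite IHv IHe.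
- move=> v bs IHv IHbs g r; rewrite IHv -!map_comp; congr Case.
  by apply: eq_map_onth => j b /IHbs IH /=; rewrite IH up.
- by move=> v t IHv g r; rewrite IHv.
Qed.

Lemma subst_id :
  (forall v, subst_val Var v = v) /\ (forall e, subst_tm Var e = e).
Proof.
apply: val_tm_ind => //=; rewrite ?upval_id.
- by move=> v w -> ->.
- by move=> e ->.
- by move=> j v ->.
- by move=> e; rewrite /upval_ty /= => ->.
- by move=> v ->.
- by move=> b v ->.
- by move=> v e -> ->.
- by move=> v bs -> IHbs; rewrite -[in RHS](map_id bs); congr Case; apply: eq_map_onth.
- by move=> v t ->.
Qed.

Lemma renE :
  (forall v r, ren_val r v = subst_val (fun x => Var (r x)) v) /\
  (forall e r, ren_tm r e = subst_tm (fun x => Var (r x)) e).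
Proof.
have up r : upval (fun x => Var (r x)) = (fun x => Var (upr r x)).
  exact/esym/scons_eta.
apply: val_tm_ind => //=.
- by move=> v w IHv IHw r; rewrite IHv IHw.
- by move=> e IHe r; rewrite IHe up.
- by move=> j v IHv r; rewrite IHv.
- by move=> e IHe r; rewrite IHe.
- by move=> v IHv r; rewrite IHv.
- by move=> b v IHv r; rewrite IHv.
- by move=> v e IHv IHe r; rewrite IHv IHe.
- move=> v bs IHv IHbs r; rewrite IHv; congr Case.
  by apply: eq_map_onth => j b /IHbs IH /=; rewrite IH up.
- by move=> v t IHv r; rewrite IHv.
Qed.

Lemma ren_subst :
  (forall v g r, ren_val r (subst_val g v) = subst_val (fun x => ren_val r (g x)) v) /\
  (forall e g r, ren_tm r (subst_tm g e) = subst_tm (fun x => ren_val r (g x)) e).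
Proof.
have up r g : (fun i => ren_val (upr r) (upval g i)) = upval (fun i => ren_val r (g i)).
  by apply: scons_eta => // i /=; rewrite [LHS](proj1 renE) [RHS](proj1 renE) !(proj1 subst_ren).
have upt r g : (fun i => ren_val r (upval_ty g i)) = upval_ty (fun i => ren_val r (g i)).
  by apply: functional_extensionality => i; rewrite /upval_ty (proj1 tsubst_ren).
apply: val_tm_ind => //=.
- by move=> v w IHv IHw g r; rewrite IHv IHw.
- by move=> e IHe g r; rewrite IHe up.
- by move=> j v IHv g r; rewrite IHv.
- by move=> e IHe g r; rewrite IHe upt.
- by move=> v IHv g r; rewrite IHv.
- by move=> b v IHv g r; rewrite IHv.
- by move=> v e IHv IHe g r; rewrite IHv IHe.
- move=> v bs IHv IHbs g r; rewrite IHv -!map_comp; congr Case.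
  by apply: eq_map_onth => j b /IHbs IH /=; rewrite IH up.
- by move=> v t IHv g r; rewrite IHv.
Qed.

(** Under [TLam] the values of a substitution have their type variables shifted. Composing value
    substitutions there requires this commutation with type substitution. *)
Lemma tsubst_subst :
  (forall v s g, tsubst_val s (subst_val g v) =
     subst_val (fun x => tsubst_val s (g x)) (tsubst_val s v)) /\
  (forall e s g, tsubst_tm s (subst_tm g e) =
     subst_tm (fun x => tsubst_val s (g x)) (tsubst_tm s e)).
Proof.
have up s g : (fun i => tsubst_val s (upval g i)) = upval (fun i => tsubst_val s (g i)).
  by apply: scons_eta => // i /=; rewrite (proj1 tsubst_ren).
have upt s g : (fun i => tsubst_val (upty s) (upval_ty g i)) =
    upval_ty (fun i => tsubst_val s (g i)).
  apply: functional_extensionality => i; rewrite /upval_ty !(proj1 tsubst_tsubst).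
  by congr tsubst_val; apply: functional_extensionality => j /=; rewrite ren_tyE.
apply: val_tm_ind => //=.
- by move=> v w IHv IHw s g; rewrite IHv IHw.
- by move=> e IHe s g; rewrite IHe up.
- by move=> j v IHv s g; rewrite IHv.
- by move=> e IHe s g; rewrite IHe upt.
- by move=> v IHv s g; rewrite IHv.
- by move=> b v IHv s g; rewrite IHv.
- by move=> v e IHv IHe s g; rewrite IHv IHe.
- move=> v bs IHv IHbs s g; rewrite IHv -!map_comp; congr Case.
  by apply: eq_map_onth => j b /IHbs IH /=; rewrite IH up.
- by move=> v t IHv s g; rewrite IHv.
Qed.

Lemma subst_subst :
  (forall v g g', subst_val g (subst_val g' v) = subst_val (fun x => subst_val g (g' x)) v) /\
  (forall e g g', subst_tm g (subst_tm g' e) = subst_tm (fun x => subst_val g (g' x)) e).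
Proof.
have up g g' : (fun i => subst_val (upval g) (upval g' i)) = upval (fun i => subst_val g (g' i)).
  by apply: scons_eta => // i /=; rewrite (proj1 subst_ren) (proj1 ren_subst).
have upt g g' : (fun i => subst_val (upval_ty g) (upval_ty g' i)) =
    upval_ty (fun i => subst_val g (g' i)).
  by apply: functional_extensionality => i; rewrite /upval_ty (proj1 tsubst_subst).
apply: val_tm_ind => //=.
- by move=> v w IHv IHw g g'; rewrite IHv IHw.
- by move=> e IHe g g'; rewrite IHe up.
- by move=> j v IHv g g'; rewrite IHv.
- by move=> e IHe g g'; rewrite IHe upt.
- by move=> v IHv g g'; rewrite IHv.
- by move=> b v IHv g g'; rewrite IHv.
- by move=> v e IHv IHe g g'; rewrite IHv IHe.
- move=> v bs IHv IHbs g g'; rewrite IHv -!map_comp; congr Case.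
  by apply: eq_map_onth => j b /IHbs IH /=; rewrite IH up.
- by move=> v t IHv g g'; rewrite IHv.
Qed.

(** A beta step on a closed instance of [Lam e] is again a closed instance of [e], with the argument
    added to the closing substitution. [tsubst_tm1_upty] plays the same part for [TLam]. *)
Lemma subst_tm1_upval w g e : subst_tm1 w (subst_tm (upval g) e) = subst_tm (scons w g) e.
Proof.
rewrite /subst_tm1 (proj2 subst_subst); congr subst_tm; apply: scons_eta => // i /=.
by rewrite (proj1 subst_ren) (proj1 subst_id).
Qed.

Lemma subst_ty1_upty u d a : subst_ty1 u (subst_ty (upty d) a) = subst_ty (scons u d) a.
Proof.
rewrite /subst_ty1 subst_subst_ty; congr subst_ty; apply: scons_eta => // i /=.
by rewrite subst_ren_ty subst_ty_id.
Qed.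

Lemma tsubst_tm1_upty u d g e :
  tsubst_tm1 u (subst_tm (upval_ty g) (tsubst_tm (upty d) e)) =
  subst_tm g (tsubst_tm (scons u d) e).
Proof.
rewrite /tsubst_tm1 (proj2 tsubst_subst) (proj2 tsubst_tsubst); congr subst_tm.
  apply: functional_extensionality => i.
  by rewrite /upval_ty (proj1 tsubst_tsubst) (proj1 tsubst_id).
congr tsubst_tm; apply: scons_eta => // i /=.
by rewrite subst_ren_ty subst_ty_id.
Qed.

Lemma subst_ty_subst1 d u a :
  subst_ty d (subst_ty1 u a) = subst_ty1 (subst_ty d u) (subst_ty (upty d) a).
Proof.
rewrite subst_ty1_upty /subst_ty1 subst_subst_ty; congr subst_ty.
exact: scons_eta.
Qed.

(** * Typing *)

Scheme val_typed_mut := Minimality for val_typed Sort Prop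
with tm_typed_mut := Minimality for tm_typed Sort Prop.
Combined Scheme typed_mut from val_typed_mut, tm_typed_mut.

Lemma wf_ren_ty k k' r t :
  wf_ty k t -> (forall i, i < k -> r i < k') -> wf_ty k' (ren_ty r t).
Proof.
elim/ty_onth_ind: t k k' r => //= [i|a b IHa IHb|a b IHa IHb|ts IHts|a IHa] k k' r.
- by move=> ik; apply.
- by case/andP=> wa wb rk; rewrite (IHa k) ?(IHb k).
- by case/andP=> wa wb rk; rewrite (IHa k) ?(IHb k).
- move=> /all_onthP wts rk; apply/all_onthP => j _ /(@onth_map_inv _ _ _ _ _ _)[a ja ->].
  by apply: (IHts j a ja k.+1); [apply: (wts j) | case].
- by move=> wa rk; apply: (IHa k.+1) => // -[].
Qed.

Lemma wf_upty k k' s : (forall i, i < k -> wf_ty k' (s i)) ->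
  forall i, i < k.+1 -> wf_ty k'.+1 (upty s i).
Proof. by move=> sk [|i] //= ik; apply: (@wf_ren_ty k') => //; apply: sk. Qed.

Lemma wf_subst_ty k k' s t :
  wf_ty k t -> (forall i, i < k -> wf_ty k' (s i)) -> wf_ty k' (subst_ty s t).
Proof.
elim/ty_onth_ind: t k k' s => //= [i|a b IHa IHb|a b IHa IHb|ts IHts|a IHa] k k' s.
- by move=> ik; apply.
- by case/andP=> wa wb sk; rewrite (IHa k) ?(IHb k).
- by case/andP=> wa wb sk; rewrite (IHa k) ?(IHb k).
- move=> /all_onthP wts sk; apply/all_onthP => j _ /(@onth_map_inv _ _ _ _ _ _)[a ja ->].
  by apply: (IHts j a ja k.+1); [apply: (wts j) | apply: wf_upty].
- by move=> wa sk; apply: (IHa k.+1) => //; apply: wf_upty.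
Qed.

Lemma wf_subst_ty1 k t a : wf_ty k t -> wf_ty k.+1 a -> wf_ty k (subst_ty1 t a).
Proof. by move=> wt wa; apply: (wf_subst_ty wa) => -[]. Qed.

Lemma wf_TMu_summand k ts j a : wf_ty k (TMu ts) -> onth ts j = Some a -> wf_ty k.+1 a.
Proof. by move=> /= /all_onthP; apply. Qed.

Lemma wf_ctx_shift k G : wf_ctx k G -> wf_ctx k.+1 (map (ren_ty succn) G).
Proof.
move=> /all_onthP wG; apply/all_onthP => j _ /(@onth_map_inv _ _ _ _ _ _)[a ja ->].
by apply: (@wf_ren_ty k); first apply: (wG j).
Qed.

Lemma typed_wf k G :
  (forall v t, val_typed k G v t -> wf_ctx k G -> wf_ty k t) /\
  (forall e t, tm_typed k G e t -> wf_ctx k G -> wf_ty k t).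
Proof.
move: k G; apply: typed_mut => //=.
- by move=> k G x t xt /all_onthP; apply; apply: xt.
- by move=> k G v1 v2 a b _ IHa _ IHb wG; rewrite IHa ?IHb.
- by move=> k G e a b wa _ IHb wG; rewrite wa IHb //= wa.
- by move=> k G e a _ IHe wG; apply/IHe/wf_ctx_shift.
- by move=> k G b v t1 t2 _ IHv /IHv /andP[]; case: b.
- by move=> k G v e a b _ IHv _ _ /IHv /andP[].
- by move=> k G v a t _ IHv wt /IHv; apply: wf_subst_ty1.
Qed.

Lemma onth_map_some (T U : Type) (f : T -> U) s j x :
  onth s j = Some x -> onth (map f s) j = Some (f x).
Proof. by move=> jx; rewrite onth_map jx. Qed.

Lemma typed_tsubst k G :
  (forall v t, val_typed k G v t ->
     forall k' s, (forall i, i < k -> wf_ty k' (s i)) ->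
     val_typed k' (map (subst_ty s) G) (tsubst_val s v) (subst_ty s t)) /\
  (forall e t, tm_typed k G e t ->
     forall k' s, (forall i, i < k -> wf_ty k' (s i)) ->
     tm_typed k' (map (subst_ty s) G) (tsubst_tm s e) (subst_ty s t)).
Proof.
move: k G; apply: typed_mut => /=.
- by move=> k G x t xt k' s sk; apply: T_Var; apply: onth_map_some.
- by move=> *; apply: T_Unit.
- by move=> k G v1 v2 a b _ IHa _ IHb k' s sk; apply: T_Pair; [apply: IHa|apply: IHb].
- move=> k G e a b wa _ IHe k' s sk; apply: T_Lam; first exact: wf_subst_ty sk.
  exact: IHe.
- move=> k G j v ts t wts jt _ IHv k' s sk.
  apply: T_In (onth_map_some _ jt) _; first exact: (@wf_subst_ty k k' s (TMu ts) wts sk).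
  by move: (IHv _ _ sk); rewrite subst_ty_subst1.
- move=> k G e a _ IHe k' s sk; apply: T_TLam.
  (* Shifting the context commutes with the substitution lifted under the binder. *)
  have := IHe _ _ (wf_upty sk); rewrite -!map_comp; congr (tm_typed _ _ _ _).
  by apply: eq_map => x /=; rewrite subst_ren_ty ren_subst_ty.
- by move=> k G v t _ IHv k' s sk; apply: T_Ret; apply: IHv.
- by move=> *; apply: T_Any.
- move=> k G b v t1 t2 _ IHv k' s sk.
  have -> : subst_ty s (if b then t1 else t2) = if b then subst_ty s t1 else subst_ty s t2.
    by case: b.
  by apply: T_Proj; apply: IHv.
- by move=> k G v e a b _ IHv _ IHe k' s sk; apply: T_App (IHv _ _ sk) (IHe _ _ sk).
- move=> k G v bs ts t _ IHv wt sz _ IHbs k' s sk.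
  apply: T_Case (IHv _ _ sk) _ _ _; rewrite ?size_map //; first exact: wf_subst_ty sk.
  move=> j y z /(@onth_map_inv _ _ _ _ _ _)[a ja ->] /(@onth_map_inv _ _ _ _ _ _)[b jb ->].
  by have := IHbs _ _ _ ja jb _ _ sk; rewrite /= subst_ty_subst1.
- move=> k G v a t _ IHv wt k' s sk; rewrite subst_ty_subst1.
  by apply: T_TApp; [apply: IHv | apply: wf_subst_ty sk].
Qed.

Lemma typed_ren k G :
  (forall v t, val_typed k G v t ->
     forall G' r, (forall x a, onth G x = Some a -> onth G' (r x) = Some a) ->
     val_typed k G' (ren_val r v) t) /\
  (forall e t, tm_typed k G e t ->
     forall G' r, (forall x a, onth G x = Some a -> onth G' (r x) = Some a) ->
     tm_typed k G' (ren_tm r e) t).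
Proof.
have up (G1 G2 : seq ty) r a : (forall x b, onth G1 x = Some b -> onth G2 (r x) = Some b) ->
    forall x b, onth (a :: G1) x = Some b -> onth (a :: G2) (upr r x) = Some b.
  by move=> rG [|x] b //=; apply: rG.
move: k G; apply: typed_mut => /=.
- by move=> k G x t xt G' r rG; apply: T_Var; apply: rG.
- by move=> *; apply: T_Unit.
- by move=> k G v1 v2 a b _ IHa _ IHb G' r rG; apply: T_Pair; [apply: IHa|apply: IHb].
- by move=> k G e a b wa _ IHe G' r rG; apply: T_Lam => //; apply/IHe/up.
- by move=> k G j v ts t wts jt _ IHv G' r rG; apply: T_In wts jt _; apply: IHv.
- move=> k G e a _ IHe G' r rG; apply: T_TLam.
  apply: IHe => x y /(@onth_map_inv _ _ _ _ _ _)[b xb ->].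
  by apply: onth_map_some; apply: rG.
- by move=> k G v t _ IHv G' r rG; apply: T_Ret; apply: IHv.
- by move=> *; apply: T_Any.
- by move=> k G b v t1 t2 _ IHv G' r rG; apply: T_Proj; apply: IHv.
- by move=> k G v e a b _ IHv _ IHe G' r rG; apply: T_App (IHv _ _ rG) (IHe _ _ rG).
- move=> k G v bs ts t _ IHv wt sz _ IHbs G' r rG.
  apply: T_Case (IHv _ _ rG) wt _ _; rewrite ?size_map //.
  by move=> j a y ja /(@onth_map_inv _ _ _ _ _ _)[b jb ->]; apply: (IHbs _ _ _ ja jb); apply: up.
- by move=> k G v a t _ IHv wt G' r rG; apply: T_TApp wt; apply: IHv.
Qed.

Lemma map_subst_TVar G (r : nat -> nat) :
  map (subst_ty (fun i => TVar (r i))) G = map (ren_ty r) G.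
Proof. by apply: eq_map => t; rewrite ren_tyE. Qed.

(** The values substituted must stay typed under binders: [typed_ren] weakens them under a term
    binder, and [typed_tsubst], applied to a shift, handles [TLam]. *)
Lemma typed_subst k G :
  (forall v t, val_typed k G v t ->
     forall G' g, (forall x a, onth G x = Some a -> val_typed k G' (g x) a) ->
     val_typed k G' (subst_val g v) t) /\
  (forall e t, tm_typed k G e t ->
     forall G' g, (forall x a, onth G x = Some a -> val_typed k G' (g x) a) ->
     tm_typed k G' (subst_tm g e) t).
Proof.
have up m (G1 G2 : seq ty) g a : (forall x b, onth G1 x = Some b -> val_typed m G2 (g x) b) ->
    forall x b, onth (a :: G1) x = Some b -> val_typed m (a :: G2) (upval g x) b.
  move=> gG [|x] b /=; first by case=> <-; apply: T_Var.
  by move=> /gG xb; apply: (proj1 (typed_ren _ _) _ _ xb).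
move: k G; apply: typed_mut => /=.
- by move=> k G x t xt G' g gG; apply: gG.
- by move=> *; apply: T_Unit.
- by move=> k G v1 v2 a b _ IHa _ IHb G' g gG; apply: T_Pair; [apply: IHa|apply: IHb].
- by move=> k G e a b wa _ IHe G' g gG; apply: T_Lam => //; apply/IHe/up.
- by move=> k G j v ts t wts jt _ IHv G' g gG; apply: T_In wts jt _; apply: IHv.
- move=> k G e a _ IHe G' g gG; apply: T_TLam.
  apply: IHe => x y /(@onth_map_inv _ _ _ _ _ _)[b xb ->].
  rewrite -map_subst_TVar ren_tyE; apply: (proj1 (typed_tsubst _ _) _ _ (gG _ _ xb)) => i.
  by rewrite /= ltnS.
- by move=> k G v t _ IHv G' g gG; apply: T_Ret; apply: IHv.
- by move=> *; apply: T_Any.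
- by move=> k G b v t1 t2 _ IHv G' g gG; apply: T_Proj; apply: IHv.
- by move=> k G v e a b _ IHv _ IHe G' g gG; apply: T_App (IHv _ _ gG) (IHe _ _ gG).
- move=> k G v bs ts t _ IHv wt sz _ IHbs G' g gG.
  apply: T_Case (IHv _ _ gG) wt _ _; rewrite ?size_map //.
  by move=> j a y ja /(@onth_map_inv _ _ _ _ _ _)[b jb ->]; apply: (IHbs _ _ _ ja jb); apply: up.
- by move=> k G v a t _ IHv wt G' g gG; apply: T_TApp wt; apply: IHv.
Qed.

Lemma Tm_subst_tm1 a b e v : tm_typed 0 [:: a] e b -> Val a v -> Tm b (subst_tm1 v e).
Proof. by move=> eb va; apply: (proj2 (typed_subst _ _) _ _ eb) => -[|[]] //= _ [<-]. Qed.

Lemma Tm_tsubst_tm1 a e u :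
  tm_typed 1 [::] e a -> wf_ty 0 u -> Tm (subst_ty1 u a) (tsubst_tm1 u e).
Proof. by move=> ea wu; apply: (proj2 (typed_tsubst _ _) _ _ ea) => -[]. Qed.

Lemma typed_close_val k G v t d g :
  val_typed k G v t -> closing k d -> Subst (map (subst_ty d) G) g ->
  Val (subst_ty d t) (subst_val g (tsubst_val d v)).
Proof.
move=> vt dk.
exact: (proj1 (typed_subst _ _) _ _ (proj1 (typed_tsubst _ _) _ _ vt _ _ dk)).
Qed.

Lemma typed_close_tm k G e t d g :
  tm_typed k G e t -> closing k d -> Subst (map (subst_ty d) G) g ->
  Tm (subst_ty d t) (subst_tm g (tsubst_tm d e)).
Proof.
move=> et dk.
exact: (proj2 (typed_subst _ _) _ _ (proj2 (typed_tsubst _ _) _ _ et _ _ dk)).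
Qed.

(** * Canonical forms of closed values *)

Lemma Val_TUnit_inv v : Val TUnit v -> v = Unit.
Proof. by move=> H; inversion H as [[|x]| | | | |]. Qed.

Lemma Val_TProd_inv a b v : Val (TProd a b) v ->
  exists v1 v2, [/\ v = Pair v1 v2, Val a v1 & Val b v2].
Proof.
move=> H; inversion H as [[|x] t xt| |v1 v2 a1 b1 H1 H2| | |] => //; subst.
by exists v1, v2.
Qed.

Lemma Val_TArr_inv a b v : Val (TArr a b) v ->
  exists2 e, v = Lam e & tm_typed 0 [:: a] e b.
Proof.
move=> H; inversion H as [[|x] t xt| | |e a1 b1 wa He| |] => //; subst.
by exists e.
Qed.

Lemma Val_TAll_inv a v : Val (TAll a) v -> exists2 e, v = TLam e & tm_typed 1 [::] e a.
Proof.
by move=> H; inversion H as [[|x] t xt| | | | |e a1 He] => //; subst; exists e.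
Qed.

(** * The interpretation of types *)

Lemma urel_ext (r r' : urel) : (forall n v v', r n v v' <-> r' n v v') -> r = r'.
Proof.
move=> E; do 3![apply: functional_extensionality => ?].
exact/propositional_extensionality/E.
Qed.

Lemma level_ext (p p' : Defs.val -> Defs.val -> Prop) :
  (forall v v', p v v' <-> p' v v') -> p = p'.
Proof.
move=> E; do 2![apply: functional_extensionality => ?].
exact/propositional_extensionality/E.
Qed.

(** * Monotonicity and locality of orthogonality *)

Lemma orth_le t t' r m n E E' : m <= n -> orth t t' r n E E' -> orth t t' r m E E'.
Proof. by move=> mn [? ? H]; split=> // j v v' jm; apply: H; apply: leq_trans mn. Qed.

Lemma biorth_le t t' r m n e e' : m <= n -> biorth t t' r n e e' -> biorth t t' r m e e'.
Proof. by move=> mn [? ? H]; split=> // j v v' jm; apply: H; apply: leq_trans mn. Qed.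

(** The bound in [may_conv_in] is strict, so nothing converges within index 0 and only typing
    remains. *)
Lemma biorth0 t t' r e e' : Tm t e -> Tm t' e' -> biorth t t' r 0 e e'.
Proof. by move=> te te'; split=> // -[|j] // E E' _ _ [m [v []]]. Qed.

Lemma orth_ext t t' (r r' : urel) n E E' : (forall j, j <= n -> r j = r' j) ->
  orth t t' r n E E' -> orth t t' r' n E E'.
Proof. by move=> rr [? ? H]; split=> // j v v' jn; rewrite -rr //; apply: H. Qed.

(** Biorthogonality at index n consults the relation only at levels up to n. This non-expansiveness
    is what makes the equation at recursive types contractive. *)
Lemma biorth_ext t t' (r r' : urel) n e e' : (forall j, j <= n -> r j = r' j) ->
  biorth t t' r n e e' -> biorth t t' r' n e e'.
Proof.
move=> rr [? ? H]; split=> // j E E' jn HE; apply: H => //.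
by apply: orth_ext HE => i ij; rewrite rr //; apply: leq_trans jn.
Qed.

(** The relation [s] is kept separate from [t]: it is a candidate fixed point at recursive types,
    and [interp t h] in the substitution lemma. *)
Definition tyrel_cons (h : nat -> tyrel) (t : ty) (s : urel) : nat -> tyrel :=
  scons (TyRel (lsub h t) (rsub h t) s) h.

(** Convertible to the list inside [interp], so that [interp_TMuE] holds by computation. *)
Definition mu_funs (h : nat -> tyrel) (ts : seq ty) : seq (urel -> urel) :=
  map (fun a s => interp a (tyrel_cons h (TMu ts) s)) ts.

Lemma interp_TMuE ts h n v v' : interp (TMu ts) h n v v' =
  exists s, mu_sol (lsub h (TMu ts)) (rsub h (TMu ts)) (mu_funs h ts) s /\ s n v v'.
Proof. by []. Qed.

(** A congruence shared by three arguments: renaming, substitution, and environments that agree only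
    up to level n. The last one is why the premises stop at level n. *)
Lemma interp_TArr_eq a b a' b' h h' n :
  lsub h (TArr a b) = lsub h' (TArr a' b') -> rsub h (TArr a b) = rsub h' (TArr a' b') ->
  (forall j, j <= n -> interp a h j = interp a' h' j) ->
  (forall j, j <= n -> interp b h j = interp b' h' j) ->
  interp (TArr a b) h n = interp (TArr a' b') h' n.
Proof.
move=> El Er Ea Eb; apply: level_ext => v v' /=; rewrite El Er.
(* [El] is convertible to an equation between arrows; injectivity of [TArr] gives the codomains. *)
have [_ Elb] : TArr (lsub h a) (lsub h b) = TArr (lsub h' a') (lsub h' b') := El.
have [_ Erb] : TArr (rsub h a) (rsub h b) = TArr (rsub h' a') (rsub h' b') := Er.
split=> -[Vl Vr [e [e' [Ev Ev' H]]]]; split=> //; exists e, e'; split=> // m w w' mn ww'.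
  rewrite -Elb -Erb.
  apply: biorth_ext (H m w w' mn _); last by rewrite Ea.
  by move=> j jm; apply: Eb; apply: leq_trans mn.
rewrite Elb Erb.
apply: biorth_ext (H m w w' mn _); last by rewrite -Ea.
by move=> j jm; rewrite Eb //; apply: leq_trans mn.
Qed.

Lemma interp_TAll_eq a a' h h' n :
  lsub h (TAll a) = lsub h' (TAll a') -> rsub h (TAll a) = rsub h' (TAll a') ->
  (forall R, lsub (scons R h) a = lsub (scons R h') a') ->
  (forall R, rsub (scons R h) a = rsub (scons R h') a') ->
  (forall R u u' s, R = TyRel u u' s -> wf_ty 0 u -> wf_ty 0 u' -> VRel u u' s ->
     forall j, j <= n -> interp a (scons R h) j = interp a' (scons R h') j) ->
  interp (TAll a) h n = interp (TAll a') h' n.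
Proof.
move=> El Er Ela Era Ea; apply: level_ext => v v' /=; rewrite El Er.
split=> -[Vl Vr [e [e' [Ev Ev' H]]]]; split=> //; exists e, e'; split=> // u u' s wu wu' us.
  by rewrite -Ela -Era; apply: biorth_ext (H u u' s wu wu' us); apply: Ea.
rewrite Ela Era; apply: biorth_ext (H u u' s wu wu' us) => j jn.
by rewrite (Ea _ u u' s).
Qed.

(** Equal lists of functions have the same solutions, so renaming and substitution need no
    fixed-point reasoning. Agreement up to a level does not give equal lists and goes through
    [mu_funs_agree] instead. *)
Lemma interp_TMu_eq ts ts' h h' :
  lsub h (TMu ts) = lsub h' (TMu ts') -> rsub h (TMu ts) = rsub h' (TMu ts') ->
  mu_funs h ts = mu_funs h' ts' -> interp (TMu ts) h = interp (TMu ts') h'.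
Proof.
by move=> El Er Es; apply: urel_ext => n v v'; rewrite !interp_TMuE El Er Es.
Qed.

(** * Renaming and substitution in the interpretation *)

Lemma lsub_ren r t h : lsub h (ren_ty r t) = lsub (fun i => h (r i)) t.
Proof. exact: subst_ren_ty. Qed.

Lemma rsub_ren r t h : rsub h (ren_ty r t) = rsub (fun i => h (r i)) t.
Proof. exact: subst_ren_ty. Qed.

Lemma interp_ren r t h : interp (ren_ty r t) h = interp t (fun i => h (r i)).
Proof.
have up R r1 h1 : (fun i => scons R h1 (upr r1 i)) = scons R (fun i => h1 (r1 i)).
  exact: scons_eta.
elim/ty_onth_ind: t r h => // [a b IHa IHb|a b IHa IHb|ts IHts|a IHa] r h.
- by rewrite /= IHa IHb.
- apply: functional_extensionality => n.
  apply: interp_TArr_eq => [||j _|j _]; rewrite ?IHa ?IHb //.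
    exact: (lsub_ren r (TArr a b)).
  exact: (rsub_ren r (TArr a b)).
- apply: interp_TMu_eq; first exact: (lsub_ren r (TMu ts)).
    exact: (rsub_ren r (TMu ts)).
  rewrite /mu_funs -map_comp; apply: eq_map_onth => j a /IHts IH.
  apply: functional_extensionality => s /=.
  by rewrite IH /tyrel_cons up -(lsub_ren r (TMu ts)) -(rsub_ren r (TMu ts)).
- apply: functional_extensionality => n.
  apply: interp_TAll_eq => [||R|R|R].
  + exact: (lsub_ren r (TAll a)).
  + exact: (rsub_ren r (TAll a)).
  + by rewrite lsub_ren up.
  + by rewrite rsub_ren up.
  + by move=> u u' s _ _ _ _ j _; rewrite IHa up.
Qed.

Definition tyrel_subst (h : nat -> tyrel) (s : nat -> ty) (i : nat) : tyrel :=
  TyRel (lsub h (s i)) (rsub h (s i)) (interp (s i) h).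

Lemma lsub_subst s t h : lsub h (subst_ty s t) = lsub (tyrel_subst h s) t.
Proof. exact: subst_subst_ty. Qed.

Lemma rsub_subst s t h : rsub h (subst_ty s t) = rsub (tyrel_subst h s) t.
Proof. exact: subst_subst_ty. Qed.

Lemma tyrel_subst_upty R h s :
  tyrel_subst (scons R h) (upty s) = scons R (tyrel_subst h s).
Proof.
apply: scons_eta => [|i]; first by case: R.
by rewrite /tyrel_subst /= lsub_ren rsub_ren interp_ren.
Qed.

(** Each binder is crossed by [tyrel_subst_upty], which rests on [interp_ren]; the functions of a
    recursive type then coincide for every candidate relation. *)
Lemma interp_subst s t h : interp (subst_ty s t) h = interp t (tyrel_subst h s).
Proof.
elim/ty_onth_ind: t s h => // [a b IHa IHb|a b IHa IHb|ts IHts|a IHa] s h.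
- by rewrite /= IHa IHb.
- apply: functional_extensionality => n.
  apply: interp_TArr_eq => [||j _|j _]; rewrite ?IHa ?IHb //.
    exact: (lsub_subst s (TArr a b)).
  exact: (rsub_subst s (TArr a b)).
- apply: interp_TMu_eq; first exact: (lsub_subst s (TMu ts)).
    exact: (rsub_subst s (TMu ts)).
  rewrite /mu_funs -map_comp; apply: eq_map_onth => j a /IHts IH.
  apply: functional_extensionality => r /=.
  by rewrite IH /tyrel_cons tyrel_subst_upty -(lsub_subst s (TMu ts)) -(rsub_subst s (TMu ts)).
- apply: functional_extensionality => n.
  apply: interp_TAll_eq => [||R|R|R].
  + exact: (lsub_subst s (TAll a)).
  + exact: (rsub_subst s (TAll a)).
  + by rewrite lsub_subst tyrel_subst_upty.
  + by rewrite rsub_subst tyrel_subst_upty.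
  + by move=> u u' r _ _ _ _ j _; rewrite IHa tyrel_subst_upty.
Qed.

Lemma tyrel_subst1 h u : tyrel_subst h (scons u TVar) = tyrel_cons h u (interp u h).
Proof.
have eta R : TyRel (lty R) (rty R) (trel R) = R by case: R.
by apply: scons_eta => // i; apply: (eta (h i)).
Qed.

Lemma interp_subst1 u a h :
  interp (subst_ty1 u a) h = interp a (tyrel_cons h u (interp u h)).
Proof. by rewrite /subst_ty1 interp_subst tyrel_subst1. Qed.

Lemma lsub_subst1 u a h s : lsub h (subst_ty1 u a) = lsub (tyrel_cons h u s) a.
Proof.
by rewrite /lsub subst_ty_subst1 subst_ty1_upty; congr subst_ty; apply/esym/scons_eta.
Qed.

Lemma rsub_subst1 u a h s : rsub h (subst_ty1 u a) = rsub (tyrel_cons h u s) a.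
Proof.
by rewrite /rsub subst_ty_subst1 subst_ty1_upty; congr subst_ty; apply/esym/scons_eta.
Qed.

(** * Uniform relations and fixed points at recursive types *)

Lemma VRel_le t t' r m n v v' : VRel t t' r -> m <= n -> r n v v' -> r m v v'.
Proof.
move=> [_ dec]; elim: n => [|n IHn]; first by rewrite leqn0 => /eqP->.
by rewrite leq_eqVlt => /predU1P[-> //|mn] /dec; apply: IHn.
Qed.

Lemma VRel_Val t t' r n v v' : VRel t t' r -> r n v v' -> Val t v /\ Val t' v'.
Proof. by move=> V /(VRel_le V (leq0n n)) /(proj1 V). Qed.

(** The clauses put level 1 of [mu_step] inside its full level 0, make its later levels decrease,
    and make each summand non-expansive. Together with the shift of one level in [mu_step], the last
    gives contractivity. *)
Definition mu_summand (l r : ty) (j : nat) (F : urel -> urel) : Prop :=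
  [/\ forall s n w w', VRel l r s -> F s n w w' -> Val l (In j w) /\ Val r (In j w'),
      forall s n w w', VRel l r s -> F s n.+1 w w' -> F s n w w' &
      forall s s' n, VRel l r s -> VRel l r s' ->
        (forall m, m <= n -> s m = s' m) -> F s n = F s' n].

Definition mu_step (l r : ty) (Fs : seq (urel -> urel)) (s : urel) : urel :=
  fun n v v' => if n is m.+1 then
    exists j F w w', [/\ onth Fs j = Some F, v = In j w, v' = In j w' & F s m w w']
  else Val l v /\ Val r v'.

(* The fixpoint is the diagonal of the iterates of the contractive map
   [mu_step], started from the full relation. *)
Lemma mu_sol_exists l r Fs :
  (forall j F, onth Fs j = Some F -> mu_summand l r j F) -> exists s, mu_sol l r Fs s.
Proof.
move=> HFs; pose S i := iter i (mu_step l r Fs) (fun _ v v' => Val l v /\ Val r v').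
have VS i : VRel l r (S i).
  elim: i => [|i IHi]; split=> //= -[|n] v v' /=.
    by move=> [j [F [w [w' [/HFs[Ht _ _] -> -> /Ht]]]]]; apply.
  move=> [j [F [w [w' [jF -> -> H]]]]]; exists j, F, w, w'; split=> //.
  by have [_ Hd _] := HFs _ _ jF; apply: Hd.
(* By contractivity the i-th iterate is already final at levels up to i. *)
have agr i m : m <= i -> S i m = S i.+1 m.
  elim: i m => [|i IHi] [|m] //; rewrite ltnS => mi; apply: level_ext => v v'.
  by split=> -[j [F [w [w' [jF -> -> H]]]]]; exists j, F, w, w'; split=> //;
    have [_ _ Hn] := HFs _ _ jF; move: H; rewrite (Hn (S i) (S i.+1)) // => p pm;
    apply: IHi; apply: leq_trans mi.
have diag i m : m <= i -> S i m = S m m.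
  elim: i => [|i IHi]; first by rewrite leqn0 => /eqP->.
  by rewrite leq_eqVlt => /predU1P[-> //|mi]; rewrite -agr // IHi.
exists (fun n => S n n); split; first split=> [v v'|n v v' H]; first exact: (proj1 (VS 0)).
  by rewrite -(diag n.+1 n) //; apply: (proj2 (VS n.+1)).
(* At levels up to n the n-th iterate and the diagonal agree, so a non-expansive F has the same
   value on both at level n. This turns the step from iterate n to n+1 into the fixed-point
   equation. *)
have E j F n : onth Fs j = Some F -> F (S n) n = F (fun n => S n n) n.
  move=> jF; have [_ _ Hn] := HFs _ _ jF; apply: Hn => // [|m mn]; last exact: diag.
  split=> [v v'|p v v' H]; first exact: (proj1 (VS 0)).
  by rewrite -(diag p.+1 p) //; apply: (proj2 (VS p.+1)).
by move=> n v v'; split=> -[j [F [w [w' [jF -> -> H]]]]]; exists j, F, w, w';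
  split=> //; move: H; rewrite (E _ _ _ jF).
Qed.

(** Strong induction on the level: level n+1 of a solution depends only on its levels up to n.
    Allowing two lists of functions yields both uniqueness and non-expansiveness in the
    environment. *)
Lemma mu_sol_agree l r Fs Fs' s s' N :
  mu_sol l r Fs s -> mu_sol l r Fs' s' -> size Fs = size Fs' ->
  (forall j F F' n, onth Fs j = Some F -> onth Fs' j = Some F' -> n < N ->
     (forall m, m <= n -> s m = s' m) -> F s n = F' s' n) ->
  forall n, n <= N -> s n = s' n.
Proof.
move=> [[s0 _] sS] [[s0' _] sS'] sz E n nN.
elim/ltn_ind: n nN => -[_ _|n IHn nN]; apply: level_ext => v v'.
  by rewrite s0 s0'.
have A m : m <= n -> s m = s' m by move=> mn; apply: IHn; [|apply: leq_trans mn (ltnW nN)].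
rewrite sS sS'; split=> -[j [F [w [w' [jF -> -> H]]]]].
  (* The lists have equal length, so the other one also has a j-th function. *)
  have [F' jF'] : exists F', onth Fs' j = Some F'.
    by case E': (onth Fs' j) (onthTE Fs' j) => [F'|]; [exists F' | rewrite -sz -onthTE jF].
  by exists j, F', w, w'; split=> //; rewrite -(E j F F').
have [F' jF'] : exists F', onth Fs j = Some F'.
  by case E': (onth Fs j) (onthTE Fs j) => [F'|]; [exists F' | rewrite sz -onthTE jF].
by exists j, F', w, w'; split=> //; rewrite (E j F' F).
Qed.

(** The types must coincide outright because they determine which values and contexts are typed;
    only the relations are compared by level. *)
Definition agree_upto (n : nat) (h h' : nat -> tyrel) : Prop :=
  forall i, [/\ lty (h i) = lty (h' i), rty (h i) = rty (h' i) &
                forall m, m <= n -> trel (h i) m = trel (h' i) m].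

Lemma agree_upto_lsub n h h' t : agree_upto n h h' -> lsub h t = lsub h' t.
Proof.
by move=> A; congr subst_ty; apply: functional_extensionality => i; case: (A i).
Qed.

Lemma agree_upto_rsub n h h' t : agree_upto n h h' -> rsub h t = rsub h' t.
Proof.
by move=> A; congr subst_ty; apply: functional_extensionality => i; case: (A i).
Qed.

Lemma agree_upto_scons n R R' h h' :
  lty R = lty R' -> rty R = rty R' -> (forall m, m <= n -> trel R m = trel R' m) ->
  agree_upto n h h' -> agree_upto n (scons R h) (scons R' h').
Proof. by move=> ? ? ? A [|i] //=. Qed.

Lemma agree_upto_le m n h h' : m <= n -> agree_upto n h h' -> agree_upto m h h'.
Proof. by move=> mn A i; have [? ? H] := A i; split=> // p pm; apply: H; apply: leq_trans mn. Qed.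

Lemma rel_env_scons k h u u' s : wf_ty 0 u -> wf_ty 0 u' -> VRel u u' s ->
  rel_env k h -> rel_env k.+1 (scons (TyRel u u' s) h).
Proof. by move=> ? ? ? H [|i] //=; apply: H. Qed.

Lemma wf_lsub k h t : rel_env k h -> wf_ty k t -> wf_ty 0 (lsub h t).
Proof. by move=> H wt; apply: (wf_subst_ty wt) => i /H[]. Qed.

Lemma wf_rsub k h t : rel_env k h -> wf_ty k t -> wf_ty 0 (rsub h t).
Proof. by move=> H wt; apply: (wf_subst_ty wt) => i /H[]. Qed.

Lemma rel_env_cons k h t s : wf_ty k t -> VRel (lsub h t) (rsub h t) s ->
  rel_env k h -> rel_env k.+1 (tyrel_cons h t s).
Proof.
by move=> wt V Hh; apply: rel_env_scons => //; [apply: wf_lsub Hh wt | apply: wf_rsub Hh wt].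
Qed.

(** Uniformity and non-expansiveness have to be proved together: a solution at [TMu] exists because
    the summands are non-expansive, and comparing two solutions requires them to be uniform. *)
Definition interp_good (t : ty) : Prop :=
  forall k h, wf_ty k t -> rel_env k h ->
    VRel (lsub h t) (rsub h t) (interp t h) /\
    (forall h' n, rel_env k h' -> agree_upto n h h' -> interp t h n = interp t h' n).

Lemma Val_In_unfold d ts j a w : wf_ty 0 (subst_ty d (TMu ts)) -> onth ts j = Some a ->
  Val (subst_ty (scons (subst_ty d (TMu ts)) d) a) w -> Val (subst_ty d (TMu ts)) (In j w).
Proof.
move=> wts ja Vw; apply: (T_In wts (onth_map_some _ ja)).
by rewrite subst_ty1_upty.
Qed.

Lemma mu_funs_summand k h ts :
  all_onth interp_good ts -> wf_ty k (TMu ts) -> rel_env k h ->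
  forall j F, onth (mu_funs h ts) j = Some F ->
  mu_summand (lsub h (TMu ts)) (rsub h (TMu ts)) j F.
Proof.
move=> good wts Hh j F /(@onth_map_inv _ _ _ _ _ _)[a ja ->].
have wa := wf_TMu_summand wts ja; have Ha := good _ _ ja.
split=> [s n w w' Vs H|s n w w' Vs|s s' n Vs Vs' A].
- have [Va _] := Ha _ _ wa (rel_env_cons wts Vs Hh).
  have [Vw Vw'] := VRel_Val Va H.
  split; apply: (Val_In_unfold _ ja); rewrite ?(wf_lsub Hh wts) ?(wf_rsub Hh wts) //.
    by move: Vw; congr (Val (subst_ty _ _) _); apply: scons_eta.
  by move: Vw'; congr (Val (subst_ty _ _) _); apply: scons_eta.
- have [Va _] := Ha _ _ wa (rel_env_cons wts Vs Hh); exact: (proj2 Va).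
- have [_ N] := Ha _ _ wa (rel_env_cons wts Vs Hh).
  by apply: N; [apply: rel_env_cons | apply: agree_upto_scons].
Qed.

Lemma mu_funs_agree k h h' ts N s s' :
  all_onth interp_good ts -> wf_ty k (TMu ts) -> rel_env k h -> rel_env k h' ->
  agree_upto N h h' ->
  mu_sol (lsub h (TMu ts)) (rsub h (TMu ts)) (mu_funs h ts) s ->
  mu_sol (lsub h' (TMu ts)) (rsub h' (TMu ts)) (mu_funs h' ts) s' ->
  forall n, n <= N -> s n = s' n.
Proof.
move=> good wts Hh Hh' A Hs Hs'; have [Vs _] := Hs; have [Vs' _] := Hs'.
have El := agree_upto_lsub (TMu ts) A; have Er := agree_upto_rsub (TMu ts) A.
rewrite -El -Er in Hs'; apply: (mu_sol_agree Hs Hs'); first by rewrite !size_map.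
move=> j F F' n /(@onth_map_inv _ _ _ _ _ _)[a ja ->]; rewrite onth_map ja => -[<-] nN E.
have wa := wf_TMu_summand wts ja.
(* Both environments are extended by their own solution; the solutions agree up to n by [E], so the
   extended environments do as well. *)
have [_ Na] := good _ _ ja _ _ wa (rel_env_cons wts Vs Hh).
apply: Na; first exact: rel_env_cons.
by apply: agree_upto_scons => //; apply: agree_upto_le (ltnW nN) A.
Qed.

(** Uniqueness, from [mu_funs_agree] with equal environments, replaces the existential in [interp]
    by any solution at hand. *)
Lemma interp_mu_sol k h ts s :
  all_onth interp_good ts -> wf_ty k (TMu ts) -> rel_env k h ->
  mu_sol (lsub h (TMu ts)) (rsub h (TMu ts)) (mu_funs h ts) s -> interp (TMu ts) h = s.
Proof.
move=> good wts Hh Hs; apply: urel_ext => n v v'; rewrite interp_TMuE.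
split=> [[s' [Hs' H]]|H]; last by exists s.
by rewrite (mu_funs_agree good wts Hh Hh _ Hs Hs' (leqnn n)) // => i.
Qed.

Lemma interp_is_good t : interp_good t.
Proof.
elim/ty_onth_ind: t => [i||a b IHa IHb|a b IHa IHb|ts IHts|a IHa] k h wt Hh.
- split=> [|h' n _ A]; last by apply: level_ext => v v' /=; have [_ _ ->] := A i.
  by have [] := Hh i wt.
- split=> //; split=> // v v'; split=> [[-> ->]|[/Val_TUnit_inv-> /Val_TUnit_inv->]] //.
  by split; apply: T_Unit.
- case/andP: wt => wa wb.
  have [Va Na] := IHa _ _ wa Hh; have [Vb Nb] := IHb _ _ wb Hh.
  split=> [|h' n Hh' A]; last by apply: level_ext => v v' /=; rewrite (Na h') ?(Nb h').
  split=> [v v'|n v v'] /=; last first.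
    move=> [v1 [v2 [v1' [v2' [-> -> H1 H2]]]]]; exists v1, v2, v1', v2'; split=> //.
      exact: (proj2 Va).
    exact: (proj2 Vb).
  split=> [[v1 [v2 [v1' [v2' [-> -> /(proj1 Va)[? ?] /(proj1 Vb)[? ?]]]]]]|].
    by split; apply: T_Pair.
  move=> [/Val_TProd_inv[v1 [v2 [-> ? ?]]] /Val_TProd_inv[v1' [v2' [-> ? ?]]]].
  by exists v1, v2, v1', v2'; split=> //; [apply/(proj1 Va) | apply/(proj1 Vb)].
- case/andP: wt => wa wb.
  have [Va Na] := IHa _ _ wa Hh; have [Vb Nb] := IHb _ _ wb Hh.
  split=> [|h' n Hh' A]; last first.
    apply: interp_TArr_eq => [||j jn|j jn].
    + exact: (agree_upto_lsub (TArr a b) A).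
    + exact: (agree_upto_rsub (TArr a b) A).
    + by apply: Na => //; apply: agree_upto_le A.
    + by apply: Nb => //; apply: agree_upto_le A.
  split=> [v v'|n v v'] /=; last first.
    move=> [Vl Vr [e [e' [Ev Ev' H]]]]; split=> //; exists e, e'; split=> // m w w' mn.
    by apply: H; apply: leqW.
  split=> [[]|[Vl Vr]] //; split=> //.
  have [[e -> He] [e' -> He']] := (Val_TArr_inv Vl, Val_TArr_inv Vr).
  (* For level 0 to be full only m = 0 has to be checked, where [biorth0] asks for typing alone. *)
  exists e, e'; split=> // -[|m] // w w' _ /(proj1 Va)[Vw Vw'].
  by apply: biorth0; [apply: Tm_subst_tm1 He Vw | apply: Tm_subst_tm1 He' Vw'].
- have [s Hs] := mu_sol_exists (mu_funs_summand IHts wt Hh).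
  rewrite (interp_mu_sol IHts wt Hh Hs); split=> [|h' n Hh' A]; first by case: Hs.
  have [s' Hs'] := mu_sol_exists (mu_funs_summand IHts wt Hh').
  rewrite (interp_mu_sol IHts wt Hh' Hs').
  exact: (mu_funs_agree IHts wt Hh Hh' A Hs Hs').
- split=> [|h' n Hh' A]; last first.
    apply: interp_TAll_eq => [||R|R|R].
    + exact: (agree_upto_lsub (TAll a) A).
    + exact: (agree_upto_rsub (TAll a) A).
    + exact/agree_upto_lsub/agree_upto_scons/A.
    + exact/agree_upto_rsub/agree_upto_scons/A.
    + move=> u u' s -> wu wu' us j jn.
      have [_] := IHa _ _ wt (rel_env_scons wu wu' us Hh).
      apply; first exact: rel_env_scons.
      by apply: agree_upto_scons => //; apply: agree_upto_le A.
  split=> [v v'|n v v'] /=; last first.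
    move=> [Vl Vr [e [e' [Ev Ev' H]]]]; split=> //; exists e, e'; split=> // u u' s wu wu' us.
    by apply: biorth_le (H u u' s wu wu' us).
  split=> [[]|[Vl Vr]] //; split=> //.
  have [[e -> He] [e' -> He']] := (Val_TAll_inv Vl, Val_TAll_inv Vr).
  exists e, e'; split=> // u u' s wu wu' us; apply: biorth0.
    have := Tm_tsubst_tm1 He wu; rewrite subst_ty1_upty.
    by congr (Tm (subst_ty _ _) _); apply/esym/scons_eta.
  have := Tm_tsubst_tm1 He' wu'; rewrite subst_ty1_upty.
  by congr (Tm (subst_ty _ _) _); apply/esym/scons_eta.
Qed.

Lemma interp_VRel k h t : wf_ty k t -> rel_env k h -> VRel (lsub h t) (rsub h t) (interp t h).
Proof. by move=> wt Hh; case: (interp_is_good wt Hh). Qed.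

(** The fixed-point equation, with the substitution lemma turning the environment extended by the
    solution into the syntactic unfolding. *)
Lemma interp_TMuS k h ts n v v' : wf_ty k (TMu ts) -> rel_env k h ->
  interp (TMu ts) h n.+1 v v' <->
  exists j a w w', [/\ onth ts j = Some a, v = In j w, v' = In j w' &
    interp (subst_ty1 (TMu ts) a) h n w w'].
Proof.
move=> wts Hh; have good : all_onth interp_good ts by move=> j a _; apply: interp_is_good.
have [s Hs] := mu_sol_exists (mu_funs_summand good wts Hh).
have Es := interp_mu_sol good wts Hh Hs.
rewrite Es (proj2 Hs); split.
  move=> [j [F [w [w' [/(@onth_map_inv _ _ _ _ _ _)[a ja ->] Ev Ev' H]]]]].
  by exists j, a, w, w'; split=> //; rewrite interp_subst1 Es.
move=> [j [a [w [w' [ja Ev Ev' H]]]]].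
exists j, (fun s => interp a (tyrel_cons h (TMu ts) s)), w, w'.
by split=> //; [rewrite onth_map ja | move: H; rewrite interp_subst1 Es].
Qed.

(** * Compatibility *)

Lemma step_plug l E e e' : step l e e' -> step l (plug E e) (plug E e').
Proof. by move=> H; elim: E => //= v E IHE; apply: S_App. Qed.

Lemma plug_neq_Ret E e : (forall v, e <> Ret v) -> forall v, plug E e <> Ret v.
Proof. by case: E. Qed.

(** A beta step at a frame of [E] requires a returned value as argument, so as long as [e] is not
    one, all reduction takes place in the hole. *)
Lemma plug_step_inv l E e e1 : (forall v, e <> Ret v) -> step l (plug E e) e1 ->
  exists2 e2, step l e e2 & e1 = plug E e2.
Proof.
move=> ne; elim: E e1 => [|v E IHE] e1 /=; first by exists e1.
move Ea: (App v (plug E e)) => e0 H; case: l e0 e1 / H IHE Ea => //.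
  by move=> e0 v0 _ [_ Er]; case: (plug_neq_Ret ne Er).
move=> l v' e' e'' He' IHE [-> Ee]; rewrite -Ee in He'.
by have [e2 He2 ->] := IHE _ He'; exists e2.
Qed.

Lemma may_conv_step l E e e' : step l e e' -> may_conv (plug E e') -> may_conv (plug E e).
Proof. by move=> H [n [v Hr]]; exists (l + n), v; apply: R_step (step_plug E H) Hr. Qed.

(** Convergence is a may property, so every left step needs some matching right step. Only the left
    label lowers the index, because convergence on the right is unbounded. *)
Lemma biorth_step t t' r n e e' : Tm t e -> Tm t' e' -> (forall v, e <> Ret v) ->
  (forall l e1, step l e e1 -> exists l' e1', step l' e' e1' /\ biorth t t' r (n - l) e1 e1') ->
  biorth t t' r n e e'.
Proof.
move=> te te' ne H; split=> // j E E' jn HE [m [v [mj Hr]]].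
move Ee: (plug E e) Hr => e0 Hr; move Ev: (Ret v) Hr => ev Hr.
case: m e0 ev / Hr mj Ee Ev => [e0 _ Ee Ev|l p e0 e1 e2 Hs Hr1 mj Ee Ev].
  by case: (plug_neq_Ret ne (etrans Ee (esym Ev))).
rewrite -Ee in Hs; rewrite -Ev in Hr1.
have [e3 Hs2 Ee1] := plug_step_inv ne Hs; rewrite Ee1 in Hr1.
have [l' [e1' [Hs' [_ _ B]]]] := H _ _ Hs2.
(* From l + p < j the remaining p unfoldings fit strictly below j - l, and [E], [E'] stay orthogonal
   at that smaller index. *)
apply: may_conv_step Hs' _; apply: (B (j - l) E E'); first exact: leq_sub2r.
  by apply: orth_le HE; apply: leq_subr.
by exists p, v; split=> //; rewrite ltn_subRL.
Qed.

Lemma biorth_Ret t t' r n v v' : VRel t t' r -> r n v v' -> biorth t t' r n (Ret v) (Ret v').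
Proof.
move=> V H; have [Vv Vv'] := VRel_Val V H; split=> [||j E E' jn [_ _ HE]].
- exact: T_Ret.
- exact: T_Ret.
- by apply: (HE j) => //; apply: VRel_le V jn H.
Qed.

Fixpoint ecomp (E F : ectx) : ectx := if E is AppR v E' then AppR v (ecomp E' F) else F.

Lemma plug_ecomp E F e : plug (ecomp E F) e = plug E (plug F e).
Proof. by elim: E => //= v E ->. Qed.

Lemma Stk_App E v a b : Stk b E -> Val (TArr a b) v -> Stk a (ecomp E (AppR v Hole)).
Proof. by move=> SE Vv e te; rewrite plug_ecomp; apply: SE; apply: T_App Vv te. Qed.

(** The function is moved into the context. The extended contexts are orthogonal at the argument
    type because, once a related argument is returned, the beta step leads to related bodies. *)
Lemma biorth_App a b h n v v' e e' :
  VRel (lsub h a) (rsub h a) (interp a h) -> interp (TArr a b) h n v v' ->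
  biorth (lsub h a) (rsub h a) (interp a h) n e e' ->
  biorth (lsub h b) (rsub h b) (interp b h) n (App v e) (App v' e').
Proof.
move=> Va [Vv Vv' [e0 [e0' [Ev Ev' H]]]] [te te' He].
split=> [||j E E' jn HE]; first exact: T_App Vv te.
  exact: T_App Vv' te'.
rewrite -[App v e]/(plug (AppR v Hole) e) -[App v' e']/(plug (AppR v' Hole) e') -!plug_ecomp.
have [SE SE' _] := HE.
apply: (He j) => //; split; [exact: Stk_App SE Vv | exact: Stk_App SE' Vv' |].
move=> i w w' ij ww'; have [Vw Vw'] := VRel_Val Va ww'.
suff [_ _ B] : biorth (lsub h b) (rsub h b) (interp b h) i (App v (Ret w)) (App v' (Ret w')).
  by rewrite !plug_ecomp; apply: (B i) => //; apply: orth_le HE.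
apply: biorth_step => //; [exact: T_App Vv (T_Ret Vw) | exact: T_App Vv' (T_Ret Vw') |].
rewrite Ev Ev' => l e1 Hs; exists false, (subst_tm1 w' e0'); split; first exact: S_Beta.
have [-> ->] : l = false /\ e1 = subst_tm1 w e0.
  by inversion Hs as [| | | | |l2 v2 e2 e3 Hs2]; subst=> //; inversion Hs2.
by rewrite subn0; apply: H => //; apply: leq_trans jn.
Qed.

Lemma biorth_Proj b a1 a2 k h n v v' : wf_ty k (TProd a1 a2) -> rel_env k h ->
  interp (TProd a1 a2) h n v v' ->
  let a := if b then a1 else a2 in
  biorth (lsub h a) (rsub h a) (interp a h) n (Proj b v) (Proj b v').
Proof.
move=> wa Hh H a; have [Vv Vv'] := VRel_Val (interp_VRel wa Hh) H.
have [wa1 wa2] := andP wa.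
move: H @a Vv Vv' => [v1 [v2 [v1' [v2' [-> -> H1 H2]]]]].
case: b => /= Vv Vv'; apply: biorth_step => //.
- exact: (@T_Proj _ _ true _ _ _ Vv).
- exact: (@T_Proj _ _ true _ _ _ Vv').
- move=> l e1 Hs; inversion Hs; subst; exists false, (Ret v1'); split; first exact: S_Proj.
  by rewrite subn0; apply: biorth_Ret => //; apply: interp_VRel Hh.
- exact: (@T_Proj _ _ false _ _ _ Vv).
- exact: (@T_Proj _ _ false _ _ _ Vv').
- move=> l e1 Hs; inversion Hs; subst; exists false, (Ret v2'); split; first exact: S_Proj.
  by rewrite subn0; apply: biorth_Ret => //; apply: interp_VRel Hh.
Qed.

(** The universal value is instantiated with [interp t h], a uniform relation by [interp_VRel];
    [interp_subst1] identifies the result. *)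
Lemma biorth_TApp a t k h n v v' : wf_ty k (TAll a) -> wf_ty k t -> rel_env k h ->
  interp (TAll a) h n v v' ->
  biorth (lsub h (subst_ty1 t a)) (rsub h (subst_ty1 t a)) (interp (subst_ty1 t a) h) n
    (TApp v (lsub h t)) (TApp v' (rsub h t)).
Proof.
move=> wa wt Hh [Vv Vv' [e [e' [Ev Ev' H]]]].
have wl := wf_lsub Hh wt; have wr := wf_rsub Hh wt.
apply: biorth_step => //.
- by rewrite [lsub h (subst_ty1 t a)]subst_ty_subst1; apply: T_TApp Vv wl.
- by rewrite [rsub h (subst_ty1 t a)]subst_ty_subst1; apply: T_TApp Vv' wr.
rewrite Ev Ev' => l e1 Hs; inversion Hs; subst.
exists false, (tsubst_tm1 (rsub h t) e'); split; first exact: S_TBeta.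
rewrite subn0 (lsub_subst1 _ _ _ (interp t h)) (rsub_subst1 _ _ _ (interp t h)) interp_subst1.
exact: H wl wr (interp_VRel wt Hh).
Qed.

(** Scrutinees related at n+1 have payloads related only at n. The unfold-fold step pays for exactly
    this loss. *)
Lemma biorth_Case ts t k h n v v' bs bs' :
  wf_ty k (TMu ts) -> rel_env k h -> size bs = size ts -> size bs' = size ts ->
  Tm (lsub h t) (Case v bs) -> Tm (rsub h t) (Case v' bs') ->
  interp (TMu ts) h n v v' ->
  (forall j a b b' m w w', onth ts j = Some a -> onth bs j = Some b -> onth bs' j = Some b' ->
     m <= n -> interp (subst_ty1 (TMu ts) a) h m w w' ->
     biorth (lsub h t) (rsub h t) (interp t h) m (subst_tm1 w b) (subst_tm1 w' b')) ->
  biorth (lsub h t) (rsub h t) (interp t h) n (Case v bs) (Case v' bs').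
Proof.
move=> wts Hh sz sz' tl tr; case: n => [|n]; first by move=> *; apply: biorth0.
move=> /(interp_TMuS _ _ _ wts Hh)[j [a [w [w' [ja Ev Ev' ww']]]]] Hb; subst.
apply: biorth_step => // l e1 Hs; inversion Hs as [| | |j0 v0 bs0 e0 jb| |]; subst.
case Eb: (onth bs' j) (onthTE bs' j) => [b'|]; last first.
  by rewrite sz' -sz -onthTE jb.
move=> _; exists true, (subst_tm1 w' b'); split; first exact: S_Case.
by rewrite subn1; apply: Hb ja jb Eb _ ww'.
Qed.

Lemma interp_num h m n : rel_env 0 h -> interp tnat h n (num m) (num m).
Proof.
move=> Hh; have wn : wf_ty 0 tnat by [].
have Vn p : Val tnat (num p).
  elim: p => [|p IHp]; first by apply: (T_In (t := TUnit)) => //; apply: T_Unit.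
  exact: (T_In (t := TVar 0)).
elim: m n => [|m IHm] [|n].
- by apply/(proj1 (interp_VRel wn Hh)); split; apply: (Vn 0).
- by apply/(interp_TMuS _ _ _ wn Hh); exists 0, TUnit, Unit, Unit.
- by apply/(proj1 (interp_VRel wn Hh)); split; apply: (Vn m.+1).
- by apply/(interp_TMuS _ _ _ wn Hh); exists 1, (TVar 0), (num m), (num m).
Qed.

(** The right side answers each choice with the same numeral. *)
Lemma biorth_Any k h n : rel_env k h ->
  biorth (lsub h tnat) (rsub h tnat) (interp tnat h) n Any Any.
Proof.
move=> Hh; have Hh0 : rel_env 0 h by [].
apply: biorth_step => //; try exact: T_Any.
move=> l e1 Hs; inversion Hs as [| | | |m|]; subst; exists false, (Ret (num m)).
split; first exact: S_Any.
by apply: biorth_Ret; [apply: (@interp_VRel 0) | apply: interp_num].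
Qed.

(** * Related environments and the fundamental theorem *)

Lemma interp_ctx_le k G h m n g g' : wf_ctx k G -> rel_env k h -> m <= n ->
  interp_ctx G h n g g' -> interp_ctx G h m g g'.
Proof.
move=> /all_onthP wG Hh mn H x t xt.
by apply: VRel_le (interp_VRel (wG _ _ xt) Hh) mn (H _ _ xt).
Qed.

Lemma interp_ctx_Subst k G h n g g' : wf_ctx k G -> rel_env k h -> interp_ctx G h n g g' ->
  Subst (map (lsub h) G) g /\ Subst (map (rsub h) G) g'.
Proof.
move=> /all_onthP wG Hh H; split=> x s /(@onth_map_inv _ _ _ _ _ _)[t xt ->];
  by have [] := VRel_Val (interp_VRel (wG _ _ xt) Hh) (H _ _ xt).
Qed.

Lemma interp_ctx_scons G h n g g' a w w' :
  interp a h n w w' -> interp_ctx G h n g g' -> interp_ctx (a :: G) h n (scons w g) (scons w' g').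
Proof. by move=> ww' H [|x] t /=; [case=> <- | apply: H]. Qed.

Lemma interp_ctx_shift G h n g g' R : interp_ctx G h n g g' ->
  interp_ctx (map (ren_ty succn) G) (scons R h) n g g'.
Proof. by move=> H x s /(@onth_map_inv _ _ _ _ _ _)[t xt ->]; rewrite interp_ren; apply: H. Qed.

Definition lclose_val h g v := subst_val g (tsubst_val (fun i => lty (h i)) v).
Definition rclose_val h g v := subst_val g (tsubst_val (fun i => rty (h i)) v).
Definition lclose_tm h g e := subst_tm g (tsubst_tm (fun i => lty (h i)) e).
Definition rclose_tm h g e := subst_tm g (tsubst_tm (fun i => rty (h i)) e).

Lemma fundamental k G :
  (forall v t, val_typed k G v t -> wf_ctx k G -> forall h n g g',
     rel_env k h -> interp_ctx G h n g g' ->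
     interp t h n (lclose_val h g v) (rclose_val h g' v)) /\
  (forall e t, tm_typed k G e t -> wf_ctx k G -> forall h n g g',
     rel_env k h -> interp_ctx G h n g g' ->
     biorth (lsub h t) (rsub h t) (interp t h) n (lclose_tm h g e) (rclose_tm h g' e)).
Proof.
have clt k1 G1 e t h n g g' : tm_typed k1 G1 e t -> wf_ctx k1 G1 -> rel_env k1 h ->
    interp_ctx G1 h n g g' ->
    Tm (lsub h t) (lclose_tm h g e) /\ Tm (rsub h t) (rclose_tm h g' e).
  move=> et wG Hh Hg; have [Hl Hr] := interp_ctx_Subst wG Hh Hg.
  by split; apply: (typed_close_tm et) => // i /Hh[].
have clv k1 G1 v t h n g g' : val_typed k1 G1 v t -> wf_ctx k1 G1 -> rel_env k1 h ->
    interp_ctx G1 h n g g' ->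
    Val (lsub h t) (lclose_val h g v) /\ Val (rsub h t) (rclose_val h g' v).
  move=> et wG Hh Hg; have [Hl Hr] := interp_ctx_Subst wG Hh Hg.
  by split; apply: (typed_close_val et) => // i /Hh[].
move: k G; apply: typed_mut => k G.
- by move=> x t xt wG h n g g' Hh; apply.
- by [].
- move=> v1 v2 a b _ IH1 _ IH2 wG h n g g' Hh Hg.
  by do 4!eexists; split; [reflexivity | reflexivity | apply: IH1 | apply: IH2].
- move=> e a b wa He IHe wG h n g g' Hh Hg.
  have [Vl Vr] := clv _ _ _ _ _ _ _ _ (T_Lam wa He) wG Hh Hg.
  split=> //; do 2!eexists; split; [reflexivity | reflexivity |] => m w w' mn ww'.
  rewrite !subst_tm1_upval; apply: IHe => //; first by rewrite /wf_ctx /= wa.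
  by apply: interp_ctx_scons => //; apply: interp_ctx_le wG Hh mn Hg.
- move=> j v ts t wts jt Hv IHv wG h n g g' Hh Hg.
  have V := interp_VRel wts Hh.
  (* Level 0 is full, so typing suffices there; at n+1 the payload has to be related only at n. *)
  case: n Hg => [|n] Hg.
    by apply/(proj1 V); apply: clv (T_In wts jt Hv) wG Hh Hg.
  apply/(interp_TMuS _ _ _ wts Hh); do 4!eexists; split; [exact: jt | reflexivity | reflexivity |].
  by apply: IHv => //; apply: interp_ctx_le wG Hh (leqnSn n) Hg.
- move=> e a He IHe wG h n g g' Hh Hg.
  have [Vl Vr] := clv _ _ _ _ _ _ _ _ (T_TLam He) wG Hh Hg.
  split=> //; do 2!eexists; split; [reflexivity | reflexivity |] => u u' s wu wu' us h'.
  have := IHe (wf_ctx_shift wG) h' n g g' (rel_env_scons wu wu' us Hh) (interp_ctx_shift _ Hg).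
  rewrite !tsubst_tm1_upty /lclose_tm /rclose_tm.
  by congr (biorth _ _ _ _ (subst_tm _ (tsubst_tm _ _)) (subst_tm _ (tsubst_tm _ _)));
    apply: scons_eta.
- move=> v t Hv IHv wG h n g g' Hh Hg; apply: biorth_Ret; last exact: IHv.
  by apply: interp_VRel Hh; apply: (proj1 (typed_wf _ _)) Hv wG.
- by move=> wG h n g g' Hh Hg; apply: biorth_Any Hh.
- move=> b v t1 t2 Hv IHv wG h n g g' Hh Hg.
  apply: (@biorth_Proj b t1 t2 k) => //; last exact: IHv.
  exact: (proj1 (typed_wf _ _)) Hv wG.
- move=> v e a b _ IHv He IHe wG h n g g' Hh Hg.
  have V := interp_VRel (proj2 (typed_wf _ _) _ _ He wG) Hh.
  by apply: (@biorth_App a b); [|apply: IHv | apply: IHe].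
- move=> v bs ts t Hv IHv wt sz Hbs IHbs wG h n g g' Hh Hg.
  have [Tl Tr] := clt _ _ _ _ _ _ _ _ (T_Case Hv wt sz Hbs) wG Hh Hg.
  have wts := proj1 (typed_wf _ _) _ _ Hv wG.
  apply: (biorth_Case wts Hh _ _ Tl Tr (IHv wG _ _ _ _ Hh Hg)); rewrite ?size_map //.
  move=> j a b b' m w w' ja; rewrite !onth_map.
  case jb: (onth bs j) => [b0|] //= [<-] [<-] mn ww'.
  rewrite !subst_tm1_upval; apply: (IHbs _ _ _ ja jb) => //.
    by rewrite /wf_ctx /= wf_subst_ty1 //; apply: wf_TMu_summand wts ja.
  by apply: interp_ctx_scons => //; apply: interp_ctx_le wG Hh mn Hg.
- move=> v a t Hv IHv wt wG h n g g' Hh Hg.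
  apply: (@biorth_TApp a t k) => //; last exact: IHv.
  exact: (proj1 (typed_wf _ _)) Hv wG.
Qed.

(** * Evaluation contexts *)

(** Self-application through the recursive type mu alpha.(alpha -> t). Since t is arbitrary, [omega]
    has every well-formed type, which makes [TLam omega] a closed value of type [TAll (TVar 0)]. *)
Definition loop : Defs.val := Lam (Case (Var 0) [:: App (Var 0) (Ret (Var 1))]).

Definition omega : tm := App loop (Ret (In 0 loop)).

Lemma omega_typed k G t : wf_ty k t -> tm_typed k G omega t.
Proof.
move=> wt; pose D := TMu [:: TArr (TVar 0) (ren_ty succn t)].
have wD : wf_ty k D by rewrite /= andbT; apply: wf_ren_ty wt _.
have ED : subst_ty1 D (TArr (TVar 0) (ren_ty succn t)) = TArr D t.
  by rewrite /subst_ty1 /= subst_ren_ty subst_ty_id.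
have loopD G' : val_typed k G' loop (TArr D t).
  apply: T_Lam wD _; apply: (T_Case (ts := [:: TArr (TVar 0) (ren_ty succn t)])) => //.
    exact: T_Var.
  move=> [|[]] // a b [<-] [<-]; rewrite ED.
  by apply: (T_App (a := D)); [apply: T_Var | apply: T_Ret; apply: T_Var].
apply: T_App (loopD G) _; apply: T_Ret; apply: (T_In wD) => //.
by rewrite ED.
Qed.

(* Terms carry no annotations on [Lam] and [In], hence need not have a unique
   type.  Here the two [Case]s force the bound variable [x] to have a type
   [TAll a] with [a[1] = 1] and [a[nat] = nat], that is, [a = TVar 0], so that
   the type of [TApp x t] can only be [t]. *)
Definition probe (t : ty) : tm :=
  App (Lam (App (Lam (App (Lam (TApp (Var 2) t))
    (Case (In 0 Unit) [:: Any; TApp (Var 2) tnat])))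
    (Case (In 0 Unit) [:: Ret Unit; TApp (Var 1) TUnit])))
    (Ret (TLam omega)).

Lemma case2_typed k G b0 b1 t : wf_ty k t -> tm_typed k (TUnit :: G) b0 t ->
  tm_typed k (TUnit :: G) b1 t -> tm_typed k G (Case (In 0 Unit) [:: b0; b1]) t.
Proof.
move=> wt H0 H1; apply: (T_Case (ts := [:: TUnit; TUnit])) => //.
  by apply: (T_In (t := TUnit)) => //; apply: T_Unit.
by move=> [|[|[]]] // a b [<-] [<-].
Qed.

Lemma probe_typed t : wf_ty 0 t -> Tm t (probe t).
Proof.
move=> wt; pose X := TAll (TVar 0).
have app_x k (G : seq ty) x u : wf_ty k u -> onth G x = Some X -> tm_typed k G (TApp (Var x) u) u.
  by move=> wu xX; apply: (T_TApp (a := TVar 0)) wu; apply: T_Var.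
apply: (T_App (a := X)); last by apply/T_Ret/T_TLam/omega_typed.
apply: T_Lam => //; apply: (T_App (a := TUnit)).
  apply: T_Lam => //; apply: (T_App (a := tnat)).
    by apply: T_Lam => //; apply: app_x.
  by apply: case2_typed => //; [apply: T_Any | apply: app_x].
by apply: case2_typed => //; [apply/T_Ret/T_Unit | apply: app_x].
Qed.

Lemma typed_App_inv k G v e b : tm_typed k G (App v e) b ->
  exists a, val_typed k G v (TArr a b) /\ tm_typed k G e a.
Proof. by move=> H; inversion H; subst; exists a. Qed.

Lemma typed_Lam_inv k G e a b : val_typed k G (Lam e) (TArr a b) -> tm_typed k (a :: G) e b.
Proof. by move=> H; inversion H. Qed.

Lemma typed_TApp_Var_inv k G x t u : tm_typed k G (TApp (Var x) t) u ->
  exists2 a, onth G x = Some (TAll a) & u = subst_ty1 t a.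
Proof.
by move=> H; inversion H as [| | | | |v a t0 Hv]; inversion Hv; subst; exists a.
Qed.

Lemma typed_case2_inv k G v b0 b1 t : tm_typed k G (Case v [:: b0; b1]) t ->
  exists a0 a1, tm_typed k (a0 :: G) b0 t /\ tm_typed k (a1 :: G) b1 t.
Proof.
move=> H; inversion H as [| | | |v0 bs [|a0 [|a1 ts]] t0 Hv wt sz Hb|] => //; subst.
by do 2!eexists; split; [apply: (Hb 0) | apply: (Hb 1)].
Qed.

Lemma probe_type_unique t u : Tm u (probe t) -> u = t.
Proof.
move=> /typed_App_inv[X [/typed_Lam_inv Hb _]].
move: Hb => /typed_App_inv[c [/typed_Lam_inv Hb H1]].
move: Hb => /typed_App_inv[c' [/typed_Lam_inv Hb H2]].
move: Hb => /typed_TApp_Var_inv[a [EX] ->]; subst X.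
move: H1 => /typed_case2_inv[a0 [a1 [H1 /typed_TApp_Var_inv[_ [<-] Ec]]]].
move: H2 => /typed_case2_inv[b0 [b1 [H2 /typed_TApp_Var_inv[_ [<-] Ec']]]].
have {}Ec : TUnit = subst_ty1 TUnit a.
  by rewrite -Ec; inversion H1 as [v s Hv| | | | |]; inversion Hv.
have {}Ec' : tnat = subst_ty1 tnat a by rewrite -Ec'; inversion H2.
(* The equation at [TUnit] leaves [TUnit] or [TVar 0] for [a], and the one at [tnat] excludes
   [TUnit]. *)
by case: a Ec Ec' {H1 H2} => [[]| | | | |].
Qed.

(* With [h i = TVar i] on both sides, [lsub h] and [rsub h] are the identity. *)
Definition id_env (i : nat) : tyrel := TyRel (TVar i) (TVar i) (fun _ _ _ => True).

Lemma lsub_id t : lsub id_env t = t. Proof. exact: subst_ty_id. Qed.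

Lemma rsub_id t : rsub id_env t = t. Proof. exact: subst_ty_id. Qed.

Lemma rel_env0 h : rel_env 0 h. Proof. by []. Qed.

Lemma interp_refl t v n : Val t v -> interp t id_env n v v.
Proof.
move=> Vv; have := proj1 (fundamental _ _) _ _ Vv isT id_env n Var Var (@rel_env0 _).
rewrite /lclose_val /rclose_val (proj1 subst_id) (proj1 tsubst_id); apply.
by case.
Qed.

(** Inverting the typing of [plug E (probe t)] recovers a type for each frame, and
    [probe_type_unique] makes the hole have type [t]. Each frame is self-related, so [biorth_App]
    carries the relation outwards. *)
Lemma biorth_plug t u E n v v' : wf_ty 0 t -> Tm u (plug E (probe t)) -> interp t id_env n v v' ->
  biorth u u (interp u id_env) n (plug E (Ret v)) (plug E (Ret v')).
Proof.
move=> wt; elim: E u => [|f E IHE] u /=.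
  move=> /probe_type_unique-> H.
  by apply: biorth_Ret H; have := interp_VRel wt (@rel_env0 id_env); rewrite lsub_id rsub_id.
move=> /typed_App_inv[a [Vf Ha]] H.
have V := interp_VRel (proj2 (typed_wf _ _) _ _ Ha isT) (@rel_env0 id_env).
have := biorth_App V (interp_refl n Vf); rewrite !lsub_id !rsub_id; apply.
exact: IHE.
Qed.

Lemma orth_refl t E n : wf_ty 0 t -> Stk t E -> orth t t (interp t id_env) n E E.
Proof.
move=> wt SE; split=> // j v v' _ H; have [u Hu] := SE _ (probe_typed wt).
have [_ _ B] := biorth_plug wt Hu H.
(* The empty context is orthogonal to itself for any relation, since a value on the right has
   already converged. *)
apply: (B j Hole Hole) => //; split=> [e Te|e Te|i w w' _ _ _]; [by exists u | by exists u |].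
by exists 0, w'; apply: R_refl.
Qed.

(** * Equivalence of the logical and CIU preorders *)

Theorem theorem4p8 (k : nat) (G : seq ty) (t : ty) (e e' : tm)
    (hG : wf_ctx k G) (he : tm_typed k G e t) (he' : tm_typed k G e' t) :
  logrel k G e e' t <-> ciu k G e e' t.
Proof.
split=> [[_ _ L] d g E dk gG SE [m [v Hr]]|C].
  pose h i := TyRel (d i) (d i) (interp (d i) id_env).
  have hE : tyrel_subst id_env d = h.
    by apply: functional_extensionality => i; rewrite /tyrel_subst lsub_id rsub_id.
  have Hh : rel_env k h.
    move=> i ik; split; [exact: dk | exact: dk |].
    by have := interp_VRel (dk i ik) (@rel_env0 id_env); rewrite lsub_id rsub_id.
  (* The given convergence uses m unfoldings and the bound is strict, hence the index m+1. By the
     substitution lemma [interp a h] interprets the closed type [subst_ty d a], where [g x] is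
     self-related. *)
  have Hg : interp_ctx G h m.+1 g g.
    move=> x a xa; rewrite -hE -interp_subst; apply: interp_refl.
    by apply: gG; apply: onth_map_some.
  have [_ _ B] := L h m.+1 g g Hh Hg.
  apply: (B m.+1 E E) => //; last by exists m, v.
  rewrite -hE -interp_subst -lsub_subst -rsub_subst lsub_id rsub_id; apply: orth_refl SE.
  exact: wf_subst_ty (proj2 (typed_wf _ _) _ _ he hG) dk.
split=> // h n g g' Hh Hg.
(* [B] takes [e] from the left closing data and [E] to [e] under the right closing data and [E'].
   CIU is then applied on the right alone, with the types [rty (h i)], [g'] and [E']. *)
have [Tl _ B] := proj2 (fundamental _ _) _ _ he hG h n g g' Hh Hg.
have [_ gG'] := interp_ctx_Subst hG Hh Hg.
have dk : closing k (fun i => rty (h i)) by move=> i /Hh[].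
split=> //; first exact: typed_close_tm he' dk gG'.
move=> j E E' jn HE /(B j E E' jn HE); apply: C => //.
by case: HE.
Qed.
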